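(* Let $n\ge1$, let $Q,B\in M_n(\mathbb{R})$ with $Q$ symmetric positive semi-definite, and let $P=\frac12\mathrm{Tr}(Q\nabla_x^2)+\langle Bx,\nabla_x\rangle$, $x\in\mathbb{R}^n$, be a hypoelliptic Ornstein-Uhlenbeck operator which admits an invariant measure $d\mu(x)=\rho(x)\,dx$. Then for every $v_0\in L^2_\mu$, the global solution $v(t)=e^{tP}v_0$ to the Cauchy problem $\partial_tv=Pv$, $v|_{t=0}=v_0$, satisfies $$\forall t>0,\ \forall\alpha,\beta\in\mathbb{N}^n,\qquad x^\alpha\partial_x^\beta v(t)=x^\alpha\partial_x^\beta(e^{tP}v_0)\in L^2_\mu .$$
   Context: Notation: $\mathrm{Tr}(Q\nabla_x^2)=\sum_{i,j}q_{i,j}\partial^2_{x_i,x_j}$ and $\langle Bx,\nabla_x\rangle=\sum_{i,j}b_{i,j}x_j\partial_{x_i}$. Hypoellipticity of $P$ is known to be equivalent to the Kalman rank condition $\mathrm{Rank}[Q^{1/2},BQ^{1/2},\dots,B^{n-1}Q^{1/2}]=n$ (the $n\times n^2$ matrix obtained by juxtaposing these blocks), and also to $\det Q_t>0$ for some (equivalently all) $t>0$, where $Q_t=\int_0^te^{sB}Qe^{sB^T}ds$. Invariant measure: when hypoelliptic, $P$ generates the Markov semigroup $(T(t)f)(x)=\frac{1}{(2\pi)^{n/2}\sqrt{\det Q_t}}\int_{\mathbb{R}^n}e^{-\frac12\langle Q_t^{-1}y,y\rangle}f(e^{tB}x-y)\,dy$, $t>0$; an invariant measure is a probability measure $\mu$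 with $\int T(t)f\,d\mu=\int f\,d\mu$ for all $t\ge0$ and all bounded continuous $f$. It is known that existence of an invariant measure is equivalent to $\sigma(B)\subset\{z\in\mathbb{C}:\mathrm{Re}\,z<0\}$, and then it is unique and given by $d\mu=\rho\,dx$ with $\rho(x)=\frac{1}{(2\pi)^{n/2}\sqrt{\det Q_\infty}}e^{-\frac12\langle Q_\infty^{-1}x,x\rangle}$, $Q_\infty=\int_0^{+\infty}e^{sB}Qe^{sB^T}ds$. $L^2_\mu=L^2(\mathbb{R}^n,d\mu)$. $(e^{tP})_{t\ge0}$ is the strongly continuous semigroup on $L^2_\mu$ generated by $P$ with domain $D(P)=\{u\in L^2_\mu:Pu\in L^2_\mu\}$ (the extension of $(T(t))_{t\ge0}$ to $L^2_\mu$). Derivatives are taken in the sense of distributions. *)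

(* Defs.v *)
From HB Require Import structures.
From mathcomp Require Import all_boot all_order all_algebra.
From mathcomp Require Import all_classical all_reals all_analysis.

Set Implicit Arguments.
Unset Strict Implicit.
Unset Printing Implicit Defensive.
Import Order.TTheory GRing.Theory Num.Theory.
Import numFieldNormedType.Exports.

Local Open Scope classical_set_scope.
Local Open Scope ring_scope.

(* Column vectors carry the product sigma-algebra, as [n.-tuple T] does in the
   library.  For T = R it is the Borel sigma-algebra of R^n. *)
Definition measure_cV_display : measure_display -> measure_display.
Proof. exact. Qed.

Section measurable_cV.
Context {d : measure_display} {T : measurableType d} (n : nat).

Let coord (i : 'I_n) (x : 'cV[T]_n) : T := x i 0.

Let cV_set0 : g_sigma_preimage coord set0.
Proof. exact: sigma_algebra0. Qed.

Let cV_setC A : g_sigma_preimage coord A -> g_sigma_preimage coord (~` A).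
Proof. exact: sigma_algebraC. Qed.

Let cV_bigcup (F : _^nat) : (forall i, g_sigma_preimage coord (F i)) ->
  g_sigma_preimage coord (\bigcup_i (F i)).
Proof. exact: sigma_algebra_bigcup. Qed.

HB.instance Definition _ := @isMeasurable.Build (measure_cV_display d)
  'cV[T]_n (g_sigma_preimage coord) cV_set0 cV_setC cV_bigcup.

End measurable_cV.

Lemma measurable_cV_coord d (T : measurableType d) n (i : 'I_n) :
  measurable_fun [set: 'cV[T]_n] (fun x => x i 0).
Proof.
move=> _ Y mY; rewrite setTI; apply: sub_sigma_algebra => /=.
rewrite -bigcup_seq/=; exists i => /=; first exact: mem_index_enum.
by exists Y => //; rewrite setTI.
Qed.

Lemma measurable_fun_cVP d d' (U : measurableType d') (T : measurableType d) n
    (f : U -> 'cV[T]_n) :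
  (forall i, measurable_fun [set: U] (fun u => f u i 0)) ->
  measurable_fun [set: U] f.
Proof.
move=> mf.
have H : (measurable : set (set 'cV[T]_n)) `<=` image_set_system setT f measurable.
  apply: smallest_sub; first exact/sigma_algebra_image/sigma_algebra_measurable.
  elim/big_ind: _ => [//|X Y sX sY A [/sX//|/sY//]|i _ A [B mB <-]].
  rewrite /image_set_system /= !setTI.
  by have := mf i measurableT _ mB; rewrite setTI.
by move=> _ A /H; rewrite /image_set_system /= setTI.
Qed.

(* The library proves this, but its canonical sigma-finite structure on [\x] is
   keyed on the two components of a pair and is not found for [m1 \x m2]. *)
Lemma sigma_finite_prod d1 d2 (T1 : measurableType d1) (T2 : measurableType d2)
    (R : realType) (m1 : {sigma_finite_measure set T1 -> \bar R})
    (m2 : {sigma_finite_measure set T2 -> \bar R}) :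
  sigma_finite setT (m1 \x m2)%E.
Proof.
have /sigma_finiteP[F [TF ndF Foo]] := sigma_finiteT m1.
have /sigma_finiteP[G [TG ndG Goo]] := sigma_finiteT m2.
exists (fun n => F n `*` G n).
  rewrite -setXTT TF TG predeqE => -[x y]; split.
    move=> [/= [n _ Fnx] [k _ Gky]]; exists (maxn n k) => //; split.
    - by move: x Fnx; exact/subsetPset/ndF/leq_maxl.
    - by move: y Gky; exact/subsetPset/ndG/leq_maxr.
  by move=> [n _ []/= ? ?]; split; exists n.
move=> k; have [? ?] := Foo k; have [? ?] := Goo k.
split; first exact: measurableX.
by rewrite product_measure1E// lte_mul_pinfty// ge0_fin_numE.
Qed.

Section lebesgue_measure_cV.
Context {R : realType}.

Definition cV_cons (n : nat) (p : R * 'cV[R]_n) : 'cV[R]_n.+1 :=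
  \col_i (if unlift ord0 i is Some j then p.2 j 0 else p.1).

Lemma measurable_cV_cons n :
  measurable_fun [set: measurableTypeR R * 'cV[R]_n] (@cV_cons n).
Proof.
apply: measurable_fun_cVP => i.
rewrite /cV_cons; under eq_fun do rewrite mxE.
case: (unlift ord0 i) => [j|]; last exact: measurable_fst.
apply: (@measurableT_comp _ _ _ _ _ _ (fun x : 'cV[R]_n => x j 0) _ snd) => //.
exact: measurable_cV_coord.
Qed.

Section step.
Variables (n : nat) (m : {sigma_finite_measure set 'cV[R]_n -> \bar R}).

Definition lebesgue_cV_step : set 'cV[R]_n.+1 -> \bar R :=
  pushforward (lebesgue_measure \x m)%E (@cV_cons n).

Let step0 : lebesgue_cV_step set0 = 0%E.
Proof. by rewrite /lebesgue_cV_step /pushforward preimage_set0 measure0. Qed.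

Let step_ge0 A : (0 <= lebesgue_cV_step A)%E.
Proof. by rewrite /lebesgue_cV_step /pushforward; exact: measure_ge0. Qed.

Let mpre A : measurable A -> measurable (@cV_cons n @^-1` A).
Proof. by move=> mA; rewrite -[X in measurable X]setTI; exact: measurable_cV_cons. Qed.

Let step_sigma_additive : semi_sigma_additive lebesgue_cV_step.
Proof.
move=> F mF tF mUF; rewrite /lebesgue_cV_step /pushforward preimage_bigcup.
apply: measure_semi_sigma_additive.
- by move=> k; exact: mpre.
- apply/trivIsetP => /= i j _ _ ij; rewrite -preimage_setI.
  by move/trivIsetP : tF => /(_ _ _ _ _ ij) ->//; rewrite preimage_set0.
- by rewrite -preimage_bigcup; exact: mpre.
Qed.

HB.instance Definition _ := isMeasure.Build _ _ _ lebesgue_cV_step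
  step0 step_ge0 step_sigma_additive.

Let step_sigma_finite : sigma_finite setT lebesgue_cV_step.
Proof.
pose tl (x : 'cV[R]_n.+1) : R * 'cV[R]_n :=
  (x 0 0, \col_i x (lift ord0 i) 0).
have consK : cancel (@cV_cons n) tl.
  move=> [a y]; rewrite /tl /cV_cons /=; congr pair.
    by rewrite mxE unlift_none.
  by apply/colP => i; rewrite !mxE liftK.
have mtl : measurable_fun [set: 'cV[R]_n.+1]
    (tl : _ -> measurableTypeR R * 'cV[R]_n).
  apply: measurable_fun_pair; first exact: measurable_cV_coord.
  apply: measurable_fun_cVP => i.
  by under eq_fun do rewrite mxE; exact: measurable_cV_coord.
have [F FT Foo] : sigma_finite setT (lebesgue_measure \x m)%E.
  exact: (sigma_finite_prod lebesgue_measure m).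
exists (fun k => tl @^-1` F k).
  by rewrite -preimage_bigcup -FT preimage_setT.
move=> k; have [mF Fk] := Foo k; split.
  by rewrite -[X in measurable X]setTI; exact: mtl.
rewrite /lebesgue_cV_step /pushforward -comp_preimage.
by rewrite (_ : tl \o _ = id)//; apply/funext => p; exact: consK.
Qed.

HB.instance Definition _ := Measure_isSigmaFinite.Build _ _ _ lebesgue_cV_step
  step_sigma_finite.

End step.

(* Iterated product of the one-dimensional Lebesgue measure, transported from
   R * R^k to R^k.+1. *)
Fixpoint lebesgue_cV (n : nat) : {sigma_finite_measure set 'cV[R]_n -> \bar R} :=
  if n is k.+1 then lebesgue_cV_step (lebesgue_cV k) else \d_(0 : 'cV[R]_0).

End lebesgue_measure_cV.

Section distributions.
Context {R : realType} {n : nat}.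
Local Notation E := 'cV[R]_n.
Implicit Types (Omega K : set E) (f g phi psi : E -> R) (i j : 'I_n)
  (s : seq 'I_n) (alpha beta : 'I_n -> nat).

Definition pderiv i f : E -> R := fun x => 'D_(delta_mx i 0) f x.

(* [pderivs [:: i1; ...; ik] f] is d_i1 (... (d_ik f)) *)
Definition pderivs s f : E -> R := foldr pderiv f s.

Definition smooth_on Omega f := forall s x, Omega x ->
  (forall i, derivable (pderivs s f) x (delta_mx i 0)) /\
  {for x, continuous (pderivs s f)}.

Definition supported_in K phi := forall x, ~ K x -> phi x = 0.

(* The elements of D(Omega), extended by zero to R^n. *)
Definition test_function Omega phi := smooth_on setT phi /\
  exists K, [/\ compact K, K `<=` Omega & supported_in K phi].

(* Distributions are functionals of which only the values on the test functions
   matter; accordingly they are compared with [eq_distribution]. *)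
Definition is_distribution Omega (u : (E -> R) -> R) :=
  (forall (a : R) phi psi, test_function Omega phi -> test_function Omega psi ->
     u (a *: phi + psi) = a * u phi + u psi) /\
  (forall K, compact K -> K `<=` Omega ->
     exists (C : R) (N : nat), forall phi (M : R),
       smooth_on setT phi -> supported_in K phi ->
       (forall s x, (size s <= N)%N -> `|pderivs s phi x| <= M) ->
       `|u phi| <= C * M).

Definition eq_distribution Omega (u v : (E -> R) -> R) :=
  forall phi, test_function Omega phi -> u phi = v phi.

Definition distribution_of f : (E -> R) -> R :=
  fun phi => \int[lebesgue_cV n]_x (f x * phi x).

Definition dist_pderiv i (u : (E -> R) -> R) : (E -> R) -> R :=
  fun phi => - u (pderiv i phi).

Definition dist_mul f (u : (E -> R) -> R) : (E -> R) -> R :=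
  fun phi => u (fun x => f x * phi x).

Definition dist_mderiv beta (u : (E -> R) -> R) : (E -> R) -> R :=
  foldr (fun i => iter (beta i) (dist_pderiv i)) u (enum 'I_n).

Definition monomial alpha : E -> R := fun x => \prod_i x i 0 ^+ alpha i.

(* The distribution [u] is (given by) an element of L^2(mu). *)
Definition in_L2 (mu : {measure set E -> \bar R}) (u : (E -> R) -> R) :=
  exists2 w : E -> R, w \in Lfun mu 2%:E &
    eq_distribution setT u (distribution_of w).

End distributions.

Section ornstein_uhlenbeck.
Context {R : realType} {n : nat} (Q B : 'M[R]_n).
Local Notation E := 'cV[R]_n.

(* P = 1/2 Tr(Q nabla^2) + <B x, nabla>, acting on distributions. *)
Definition OU_operator (u : (E -> R) -> R) : (E -> R) -> R := fun phi =>
  2^-1 * (\sum_i \sum_j Q i j * dist_pderiv i (dist_pderiv j u) phi) +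
  \sum_i \sum_j B i j * dist_mul (fun x => x j 0) (dist_pderiv i u) phi.

Definition hypoelliptic := forall Omega (u : (E -> R) -> R),
  open Omega -> is_distribution Omega u ->
  (exists2 f, smooth_on Omega f &
     eq_distribution Omega (OU_operator u) (distribution_of f)) ->
  exists2 g, smooth_on Omega g & eq_distribution Omega u (distribution_of g).

Definition expmx (A : 'M[R]_n) : 'M[R]_n :=
  limn (series (fun k => k`!%:R^-1 *: A ^+ k)).

Definition OU_covariance_integrand (s : R) : 'M[R]_n :=
  expmx (s *: B) *m Q *m expmx (s *: B^T).

Definition Q_at (t : R) : 'M[R]_n :=
  \matrix_(i, j) \int[lebesgue_measure]_(s in `[0, t])
    OU_covariance_integrand s i j.

Definition Q_infty : 'M[R]_n :=
  \matrix_(i, j) \int[lebesgue_measure]_(s in `[0, +oo[)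
    OU_covariance_integrand s i j.

(* Density of the centered normal law with covariance matrix [S]; the invariant
   density rho is [gaussian Q_infty]. *)
Definition gaussian (S : 'M[R]_n) (x : E) : R :=
  ((2 * pi) `^ (n%:R / 2) * Num.sqrt (\det S))^-1 *
  expR (- 2^-1 * ((x^T *m invmx S *m x) 0 0)).

Definition markov_semigroup (t : R) (f : E -> R) : E -> R :=
  if t == 0 then f else
  fun x => \int[lebesgue_cV n]_y (gaussian (Q_at t) y * f (expmx (t *: B) *m x - y)).

Definition bounded_continuous (f : E -> R) :=
  continuous f /\ exists M, forall x, `|f x| <= M.

Definition invariant_measure (mu : {measure set E -> \bar R}) :=
  forall t f, 0 <= t -> bounded_continuous f ->
    \int[mu]_x markov_semigroup t f x = \int[mu]_x f x.

Definition has_density (mu : {measure set E -> \bar R}) (rho : E -> R) :=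
  forall A, measurable A -> mu A = (\int[lebesgue_cV n]_(x in A) (rho x)%:E)%E.

End ornstein_uhlenbeck.

Section semigroups.
Context {R : realType} {n : nat} (mu : {measure set 'cV[R]_n -> \bar R}).
Local Notation E := 'cV[R]_n.
Local Notation L2 := (Lfun mu 2%:E).
Local Notation norm2 f := (Lnorm mu 2%:E (EFin \o f)).

(* Operators on L^2(mu) are given on representatives, and L^2(mu) identities
   are almost everywhere identities. *)
Record C0_semigroup (S : R -> (E -> R) -> (E -> R)) : Prop := {
  C0_L2 : forall t u, 0 <= t -> u \in L2 -> S t u \in L2;
  C0_ae : forall t u v, 0 <= t -> u \in L2 -> v \in L2 ->
    {ae mu, forall x, u x = v x} -> {ae mu, forall x, S t u x = S t v x};
  C0_linear : forall t (a : R) u v, 0 <= t -> u \in L2 -> v \in L2 ->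
    {ae mu, forall x, S t (a *: u + v) x = a * S t u x + S t v x};
  C0_bounded : forall t, 0 <= t -> exists C : R, forall u, u \in L2 ->
    (norm2 (S t u) <= C%:E * norm2 u)%E;
  C0_0 : forall u, u \in L2 -> {ae mu, forall x, S 0 u x = u x};
  C0_add : forall s t u, 0 <= s -> 0 <= t -> u \in L2 ->
    {ae mu, forall x, S (s + t) u x = S s (S t u) x};
  C0_continuous : forall u, u \in L2 ->
    norm2 (S t u - u) @[t --> 0^'+] --> 0%E
}.

(* [u] is in the domain of the infinitesimal generator of [S], which maps it
   to [w]. *)
Definition in_generator (S : R -> (E -> R) -> (E -> R)) (u w : E -> R) :=
  [/\ u \in L2, w \in L2 &
      norm2 (h^-1 *: (S h u - u) - w) @[h --> 0^'+] --> 0%E].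

(* The graph of the operator P with domain {u in L^2(mu) : P u in L^2(mu)}. *)
Definition in_OU_graph (Q B : 'M[R]_n) (u w : E -> R) :=
  [/\ u \in L2, w \in L2 &
      eq_distribution setT (OU_operator Q B (distribution_of u))
        (distribution_of w)].

(* [S t] is e^{tP}: the C0-semigroup on L^2(mu) generated by P on its maximal
   domain, which is also the extension of the Markov semigroup to L^2(mu). *)
Record OU_semigroup (Q B : 'M[R]_n) (S : R -> (E -> R) -> (E -> R)) : Prop := {
  OU_C0 : C0_semigroup S;
  OU_generator : forall u w, in_generator S u w <-> in_OU_graph Q B u w;
  OU_extends : forall t f, 0 <= t -> bounded_continuous f ->
    {ae mu, forall x, S t f x = markov_semigroup Q B t f x}
}.

End semigroups.

(* Main.v *)
(* Write e^{tP} by Mehler's formula, with kernel g(Ax - z) dz where g is the normal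
   density of covariance Q_t and A = e^{tB}.  With respect to the invariant measure
   mu = rho dx, every kernel m(x, z) g(Ax - z) / rho(z) with m polynomial is
   Hilbert-Schmidt, because g(Ax - z)^2 rho(x) / rho(z) is the exponential of a
   negative definite quadratic form on R^{2n}.  Multiplication by x_j and
   differentiation in x only change the polynomial m, so
   x^alpha d^beta e^{tP} v_0 is again the image of v_0 under such an operator.

   The nondegeneracy of Q_t and Q_infty and the negative definiteness are read off
   the normalization and the invariance of mu: invariance says that rho(z) is the
   integral of rho(x) g(Ax - z) over x, and a Gaussian marginal is compared with the
   joint density through the parallelogram identity.  Mehler's formula, known for
   bounded continuous v_0, extends to L^2 by density since both sides are bounded
   operators. *)

Require Import Defs.
From HB Require Import structures.
From mathcomp Require Import all_boot all_order all_algebra.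
From mathcomp Require Import all_classical all_reals all_analysis.
From mathcomp Require Import measurable_realfun ring lra.

Set Implicit Arguments.
Unset Strict Implicit.
Unset Printing Implicit Defensive.
Import Order.TTheory GRing.Theory Num.Theory.
Import numFieldNormedType.Exports.

Local Open Scope classical_set_scope.
Local Open Scope ring_scope.

(** * Lebesgue measure on R^n *)

(** The matrices give no direct hold: [invmx] and the inverse square root of a determinant have
    default values, and the proof derives neither the positivity of [Q_at] nor its relation to
    [Q_infty] from the integrals that define them. It keeps only the inverse covariances [M], [N]
    and the two normalizing constants, and extracts everything from integral identities.

    Invariance yields that [qf M (A x - z) + qf N x - qf N z] is nonnegative. This form cannot be
    definite: it vanishes when [x] is the conditional mean given [z]. Definiteness is gained from
    the square in the Hilbert-Schmidt norm, which leaves an additional half of [qf M (A x - z)] in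
    the exponent.

    Since [v_0] is only square integrable, no derivative is taken under the integral that defines
    [e^{tP} v_0]. Fubini brings the pairing with a test function to an integral in [x] for fixed
    [z], where the kernel is smooth and can be integrated by parts. *)

Section integral_cV.
Context {R : realType}.
Local Open Scope ereal_scope.

Lemma ge0_integral_lebesgue_cVS n (f : 'cV[R]_n.+1 -> \bar R) :
  measurable_fun setT f -> (forall x, 0 <= f x) ->
  \int[lebesgue_cV n.+1]_x f x =
  \int[lebesgue_measure]_a \int[lebesgue_cV n]_y f (cV_cons (a, y)).
Proof.
move=> mf f0.
transitivity (\int[(lebesgue_measure \x lebesgue_cV n)%E]_p f (cV_cons p)).
  rewrite -[RHS](@ge0_integral_pushforward _ _ _ _ R _ (@measurable_cV_cons R n)
    (lebesgue_measure \x lebesgue_cV n)%E setT f) //.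
by rewrite fubini_tonelli1 //; apply: measurableT_comp => //; exact: measurable_cV_cons.
Qed.

Lemma measurable_cV_section n (f : 'cV[R]_n.+1 -> \bar R) :
  measurable_fun setT f -> (forall x, 0 <= f x) ->
  measurable_fun [set: measurableTypeR R]
    (fun a => \int[lebesgue_cV n]_y f (cV_cons (a, y))).
Proof.
move=> mf f0.
apply: (measurable_fun_fubini_tonelli_F
  (fun p : measurableTypeR R * 'cV[R]_n => f (cV_cons p))) => //.
by apply: measurableT_comp => //; exact: measurable_cV_cons.
Qed.

(** Reflections come before translations because Mehler's formula evaluates [f] at [A x - y]; a
    translation is then the composite of two reflections. By uniqueness of Lebesgue measure it is
    enough to compare the length of []a, b]] with that of its preimage [[c - b, c - a[]. *)
Lemma ge0_integral_reflectR (c : R) (f : R -> \bar R) :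
  measurable_fun setT f -> (forall x, 0 <= f x) ->
  \int[lebesgue_measure]_x f (c - x)%R = \int[lebesgue_measure]_x f x.
Proof.
move=> mf f0.
have mphi : measurable_fun [set: measurableTypeR R]
    (fun x => (c - x)%R : measurableTypeR R) by exact: measurable_funB.
rewrite -(@ge0_integral_pushforward _ _ _ _ R _ mphi lebesgue_measure setT f) //.
apply: eq_measure_integral => A mA _.
apply/esym/lebesgue_measure_unique => //.
move=> _ [[a b]] _ <- /=.
rewrite /pushforward.
have -> : (fun x : R => (c - x)%R) @^-1` `]a, b]%classic = `[(c - b)%R, (c - a)%R[%classic.
  by apply/seteqP; split => x /=; rewrite !in_itv/= => /andP[? ?]; apply/andP; split; lra.
rewrite !lebesgue_measure_itv/= !lte_fin ltrD2l ltrN2; case: ifPn => // _.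
by rewrite !EFinB -!EFinD; congr EFin; ring.
Qed.

Lemma measurable_cVB n (h : 'cV[R]_n) :
  measurable_fun setT (fun x : 'cV[R]_n => h - x)%R.
Proof.
apply: measurable_fun_cVP => i.
under eq_fun do rewrite !mxE.
by apply: measurable_funB => //; exact: measurable_cV_coord.
Qed.

Lemma measurable_cVD n (h : 'cV[R]_n) :
  measurable_fun setT (fun x : 'cV[R]_n => x + h)%R.
Proof.
apply: measurable_fun_cVP => i.
under eq_fun do rewrite !mxE.
by apply: measurable_funD => //; exact: measurable_cV_coord.
Qed.

Lemma ge0_integral_reflect n (h : 'cV[R]_n) (f : 'cV[R]_n -> \bar R) :
  measurable_fun setT f -> (forall x, 0 <= f x) ->
  \int[lebesgue_cV n]_x f (h - x)%R = \int[lebesgue_cV n]_x f x.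
Proof.
elim: n => [|n IH] in h f *; move=> mf f0.
  by apply: eq_integral => x _; rewrite [(h - x)%R]flatmx0 [x]flatmx0.
rewrite ge0_integral_lebesgue_cVS//; last first.
  by apply: measurableT_comp => //; exact: measurable_cVB.
pose tl := \col_i h (lift ord0 i) ord0.
have consB a y : (h - cV_cons (a, y))%R = cV_cons ((h ord0 ord0 - a)%R, (tl - y)%R).
  apply/colP => i; rewrite !mxE; case: unliftP => [j ->|->]/=; by rewrite ?mxE.
under eq_integral => a _.
  under eq_integral => y _ do rewrite consB.
  rewrite (IH tl (fun y => f (cV_cons (_, y))))//; last first.
    apply: measurableT_comp => //.
    apply: (@measurableT_comp _ _ _ _ _ _ (@cV_cons R n)); first exact: measurable_cV_cons.
    exact: measurable_fun_pair.
  over.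
rewrite (ge0_integral_reflectR (h ord0 ord0)
  (f := fun a => \int[lebesgue_cV n]_y f (cV_cons (a, y)))).
- by rewrite ge0_integral_lebesgue_cVS.
- exact: measurable_cV_section.
- by move=> x; exact: integral_ge0.
Qed.

Lemma integral_reflect n (h : 'cV[R]_n) (f : 'cV[R]_n -> \bar R) :
  measurable_fun [set: 'cV[R]_n] f ->
  \int[lebesgue_cV n]_x f (h - x)%R = \int[lebesgue_cV n]_x f x.
Proof.
move=> mf; rewrite integralE [RHS]integralE; congr (_ - _).
  rewrite -[RHS](ge0_integral_reflect h).
  - by apply: eq_integral => x _; rewrite !funeposE.
  - exact: measurable_funepos.
  - by move=> x; exact: funepos_ge0.
rewrite -[RHS](ge0_integral_reflect h).
- by apply: eq_integral => x _; rewrite !funenegE.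
- exact: measurable_funeneg.
- by move=> x; exact: funeneg_ge0.
Qed.

Lemma integral_translate n (h : 'cV[R]_n) (f : 'cV[R]_n -> \bar R) :
  measurable_fun [set: 'cV[R]_n] f ->
  \int[lebesgue_cV n]_x f (x + h)%R = \int[lebesgue_cV n]_x f x.
Proof.
move=> mf; rewrite -[RHS](integral_reflect h)//.
rewrite -[RHS](integral_reflect 0)//.
  by apply: eq_integral => x _; rewrite sub0r opprK addrC.
by apply: measurableT_comp => //; exact: measurable_cVB.
Qed.

End integral_cV.

Section sq_norm.
Context {R : realType} {n : nat}.

Definition sqn (x : 'cV[R]_n) : R := \sum_i x i 0 ^+ 2.

Lemma sqn_ge0 x : 0 <= sqn x.
Proof. by apply: sumr_ge0 => i _; exact: sqr_ge0. Qed.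

Lemma measurable_sqn : measurable_fun setT sqn.
Proof.
apply: measurable_sum => i; apply: measurable_funX.
exact: measurable_cV_coord.
Qed.

End sq_norm.

Lemma integral_gaussR_lty {R : realType} (e : R) : 0 < e ->
  (\int[lebesgue_measure]_x (expR (- (e * x ^+ 2)))%:E < +oo)%E.
Proof.
(* The standard deviation with [1 / (2 s ^ 2) = e]. *)
move=> e0; pose s := Num.sqrt ((2 * e)^-1).
have s0 : s != 0 by rewrite gt_eqF// sqrtr_gt0 invr_gt0 mulr_gt0.
have s2 : s ^+ 2 = (2 * e)^-1 by rewrite sqr_sqrtr// invr_ge0 mulr_ge0// ltW.
have -> : (fun x : R => (expR (- (e * x ^+ 2)))%:E) =
    (fun x : R => ((normal_peak s)^-1)%:E * (normal_pdf 0 s x)%:E)%E.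
  apply/funext => x; rewrite normal_pdfE// /normal_fun -EFinM; congr EFin.
  rewrite [RHS]mulrA mulVf ?mul1r; last by rewrite gt_eqF// normal_peak_gt0.
  congr expR; rewrite subr0 s2 -mulr_natr invfM; move: (gt_eqF e0) => en.
  by field; rewrite en.
rewrite ge0_integralZl//.
- by rewrite integral_normal_pdf mule1 ltry.
- by apply/measurable_EFinP; exact: measurable_normal_pdf.
- by move=> x _; rewrite lee_fin normal_pdf_ge0.
- by rewrite lee_fin invr_ge0 normal_peak_ge0.
Qed.

Lemma measurable_expsqn {R : realType} n (e : R) :
  measurable_fun setT (fun x : 'cV[R]_n => expR (- (e * sqn x))).
Proof.
apply: measurableT_comp => //; apply: measurableT_comp => //.
by apply: measurable_funM => //; exact: measurable_sqn.
Qed.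

Lemma integral_expsqn_lty {R : realType} n (e : R) : 0 < e ->
  (\int[lebesgue_cV n]_x (expR (- (e * sqn x)))%:E < +oo)%E.
Proof.
move=> e0; elim: n => [|n IH].
  rewrite integral_dirac//; last by apply/measurable_EFinP; exact: measurable_expsqn.
  by rewrite diracT mul1e ltry.
rewrite ge0_integral_lebesgue_cVS; last 2 first.
- by apply/measurable_EFinP; exact: measurable_expsqn.
- by move=> x; rewrite lee_fin expR_ge0.
have E a (y : 'cV[R]_n) : sqn (cV_cons (a, y)) = a ^+ 2 + sqn y.
  rewrite /sqn big_ord_recl; congr (_ + _); first by rewrite mxE unlift_none.
  by apply: eq_bigr => i _; rewrite mxE liftK.
set I := (\int[lebesgue_cV n]_x _)%E in IH *.
under eq_integral => a _.
  under eq_integral => y _ do rewrite E mulrDr opprD expRD EFinM.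
  rewrite ge0_integralZl//; last first.
    by apply/measurable_EFinP; exact: measurable_expsqn.
  over.
rewrite ge0_integralZr//.
- apply: lte_mul_pinfty => //.
  + by apply: integral_ge0 => x _; rewrite lee_fin expR_ge0.
  + rewrite ge0_fin_numE; first exact: integral_gaussR_lty.
    by apply: integral_ge0 => x _; rewrite lee_fin expR_ge0.
- apply/measurable_EFinP; apply: measurableT_comp => //; apply: measurableT_comp => //.
  by apply: measurable_funM => //; exact: measurable_funX.
- by apply: integral_ge0 => x _; rewrite lee_fin expR_ge0.
Qed.

(** Continuity refers to the norm topology and measurability to the product sigma-algebra. They are
    reconciled by writing an open set as a countable union of boxes with rational centre and
    radius. *)
Lemma continuous_measurable_cV {R : realType} n (f : 'cV[R]_n -> R) :
  continuous f -> measurable_fun setT f.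
Proof.
move=> cf; apply: (measurability (@RGenOpens.G R)).
  exact: RGenOpens.measurableE.
move=> _ [_ [a [b ->]] <-]; rewrite setTI.
set U := f @^-1` _.
have oU : open U by apply: open_comp => // x _; exact: cf.
pose box (q : 'cV[rat]_n * rat) : set 'cV[R]_n :=
  [set x | forall i, `|ratr (q.1 i 0) - x i 0| < ratr q.2].
have mbox q : measurable (box q).
  have -> : box q = \big[setI/setT]_(i < n)
      ((fun x : 'cV[R]_n => x i 0) @^-1` [set a | `|ratr (q.1 i 0) - a| < ratr q.2]).
      rewrite -bigcap_seq/=; apply/seteqP; split => x /=.
      by move=> h i _; exact: h.
    by move=> h i; exact: h (mem_index_enum i).
  apply: bigsetI_measurable => i _.
  rewrite -[X in measurable X]setTI; apply: measurable_cV_coord => //.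
  rewrite (_ : [set _ | _] = `]ratr (q.1 i 0) - ratr q.2, ratr (q.1 i 0) + ratr q.2[%classic) //.
  apply/seteqP; split => c /=; rewrite in_itv/= ltr_distlC => /andP[? ?]; apply/andP; split; lra.
have -> : U = \bigcup_(q in [set q | box q `<=` U]) box q.
  apply/seteqP; split => [x Ux|x [q /= qU /qU]//].
  have /nbhs_ballP[e /= e0 xeU] : nbhs x U by exact: open_nbhs_nbhs.
  (* A box of radius [r < e / 2] whose centre is within [r] of [x] contains [x] and lies in the ball
     of radius [e] about [x]. *)
  have e2 : 0 < e / 2 by rewrite divr_gt0.
  have [r] := rat_in_itvoo e2; rewrite in_itv/= => /andP[r0 re].
  have dense i : exists q : rat, `|ratr q - x i 0| < ratr r.
    have xr : x i 0 - ratr r < x i 0 + ratr r by lra.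
    have [q] := rat_in_itvoo xr; rewrite in_itv/= => qx; exists q; by rewrite ltr_distl.
  have [q qx] := choice dense.
  exists (\col_i q i, r); last by move=> i /=; rewrite mxE.
  move=> y /= yq; apply: xeU; split => // i j; rewrite (ord1 j).
  have := yq i; rewrite !mxE => yqi.
  rewrite /ball/= (le_lt_trans (ler_distD (ratr (q i)) _ _))//.
  by have := qx i; rewrite distrC => qxi; lra.
rewrite bigcup_mkcond; apply: countable_bigcupT_measurable => [|q]; [exact: countableP|by case: ifP].
Qed.

(** * Integration against a measure with a density *)

Section density.
Import HBNNSimple.
Local Open Scope ereal_scope.
Context d (T : measurableType d) (R : realType).
Variables (nu mu : {measure set T -> \bar R}) (rho : T -> R).
Hypotheses (mrho : measurable_fun [set: T] rho) (rho0 : forall x, (0 <= rho x)%R).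
Hypothesis muE : forall A, measurable A -> mu A = \int[nu]_(x in A) (rho x)%:E.

Let ge0_integral_density_nnsfun (f : {nnsfun T >-> R}) :
  \int[mu]_x (f x)%:E = \int[nu]_x ((f x)%:E * (rho x)%:E).
Proof.
under eq_integral do rewrite fimfunE -fsumEFin//.
rewrite ge0_integral_fsum//; last 2 first.
- by move=> r; exact/measurable_EFinP/measurableT_comp.
- by move=> r x _; rewrite nnfun_muleindic_ge0.
under [RHS]eq_integral.
  move=> x _; rewrite fimfunE -fsumEFin// ge0_mule_fsuml; last first.
    by move=> r; rewrite nnfun_muleindic_ge0.
  over.
rewrite ge0_integral_fsum//; last 2 first.
- move=> r; apply: emeasurable_funM; last exact/measurable_EFinP.
  exact/measurable_EFinP/measurableT_comp.
- move=> r x _; rewrite mule_ge0 ?lee_fin//; by rewrite -lee_fin EFinM nnfun_muleindic_ge0.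
apply: eq_fsbigr => r _.
rewrite integralZl_indic_nnsfun//= integral_indic//= setIT muE//.
have [->|[r0|r0]] : (r = 0 \/ 0 < r \/ r < 0)%R by lra.
- by rewrite mul0e integral0_eq// => x _; rewrite mul0r mul0e.
- under [RHS]eq_integral do rewrite EFinM -muleA.
  rewrite ge0_integralZl//; last 3 first.
  + apply: emeasurable_funM; last exact/measurable_EFinP.
    exact/measurable_EFinP/measurable_indic.
  + by move=> x _; rewrite mule_ge0// lee_fin.
  + by rewrite lee_fin ltW.
  congr (_ * _); rewrite integral_mkcond; apply: eq_integral => x _.
  by rewrite patchE indicE; case: ifPn => _; rewrite ?mul1e ?mul0e.
- have -> : f @^-1` [set r] = set0.
    by apply/preimage10 => -[x _ /= fxr]; move: r0; rewrite -fxr ltNge fun_ge0.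
  rewrite integral_set0 mule0 integral0_eq// => x _.
  by rewrite indic0 mulr0 mul0e.
Qed.

Lemma ge0_integral_density (f : T -> \bar R) :
  measurable_fun [set: T] f -> (forall x, 0 <= f x) ->
  \int[mu]_x f x = \int[nu]_x (f x * (rho x)%:E).
Proof.
move=> mf f0; pose f_ := nnsfun_approx measurableT mf.
have fE x : f x = limn (fun n => (f_ n x)%:E).
  by apply/esym/cvg_lim => //; apply: cvg_nnsfun_approx.
transitivity (limn (fun n => \int[mu]_x (f_ n x)%:E)).
  rewrite -monotone_convergence//.
  - by apply: eq_integral => x _.
  - by move=> n; exact/measurable_EFinP.
  - by move=> n x _; rewrite lee_fin.
  - by move=> x _ m n mn; rewrite lee_fin; exact/lefP/nd_nnsfun_approx.
under eq_fun do rewrite ge0_integral_density_nnsfun.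
rewrite -monotone_convergence//.
- apply: eq_integral => x _; apply/cvg_lim => //.
  by apply: cvgeZr => //; apply: cvg_nnsfun_approx.
- move=> n; apply: emeasurable_funM; exact/measurable_EFinP.
- by move=> n x _; rewrite mule_ge0// lee_fin.
- move=> x _ m n mn; rewrite lee_wpmul2r ?lee_fin//.
  exact/lefP/nd_nnsfun_approx.
Qed.

End density.

Lemma dominated_cvg_EFin d (T : measurableType d) (R : realType)
    (mu : {measure set T -> \bar R}) (f_ : (T -> R)^nat) (f g : T -> R) :
  (forall k, measurable_fun [set: T] (f_ k)) ->
  (forall x, f_ k x @[k --> \oo] --> f x) ->
  mu.-integrable [set: T] (EFin \o g) ->
  (forall k x, `|f_ k x| <= g x) ->
  (\int[mu]_x (f_ k x)%:E)%E @[k --> \oo] --> (\int[mu]_x (f x)%:E)%E.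
Proof.
move=> mf ff ig fg.
apply: (@dominated_cvg _ _ _ mu _ measurableT (fun k x => (f_ k x)%:E)
  (EFin \o f) (EFin \o g)) => //.
- by move=> k; exact/measurable_EFinP.
- by move=> x _; apply: cvg_EFin => //; [exact: nearW|exact: ff].
- by move=> k x _; rewrite lee_fin; exact: fg.
Qed.

(** * Quadratic forms and Gaussians *)

Section quadratic_forms.
Context {R : realType} {n : nat}.
Implicit Types (M N A : 'M[R]_n) (x y z : 'cV[R]_n).

Definition qf M x : R := (x^T *m M *m x) 0 0.
(** The polar form [qf M (x + y) - qf M x - qf M y]. Both orders are summed because [M] is not
    assumed symmetric; thus [sbf M x x] is [2 * qf M x]. *)
Definition sbf M x y : R := (x^T *m M *m y) 0 0 + (y^T *m M *m x) 0 0.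

Lemma qfE M x : qf M x = \sum_i \sum_j x i 0 * M i j * x j 0.
Proof.
rewrite /qf -mulmxA mxE; apply: eq_bigr => i _.
rewrite !mxE mulr_sumr; apply: eq_bigr => j _; by rewrite mulrA.
Qed.

Lemma qf0 M : qf M 0 = 0.
Proof. by rewrite /qf mulmx0 mxE. Qed.

Lemma qfZ M a x : qf M (a *: x) = a ^+ 2 * qf M x.
Proof. by rewrite /qf [(_ *: _)^T]linearZ/= -!scalemxAl -scalemxAr !mxE; ring. Qed.

Lemma sbfZl M a x y : sbf M (a *: x) y = a * sbf M x y.
Proof. by rewrite /sbf [(_ *: _)^T]linearZ/= -!scalemxAl -scalemxAr !mxE; ring. Qed.

Lemma sbfC M x y : sbf M x y = sbf M y x.
Proof. by rewrite /sbf addrC. Qed.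

Lemma sbfZr M a x y : sbf M x (a *: y) = a * sbf M x y.
Proof. by rewrite sbfC sbfZl sbfC. Qed.

Lemma qfD M x y : qf M (x + y) = qf M x + sbf M x y + qf M y.
Proof. by rewrite /qf /sbf [(_ + _)^T]linearD/= !mulmxDl !mulmxDr !mxE; ring. Qed.

Lemma qfN M x : qf M (- x) = qf M x.
Proof. by rewrite -scaleN1r qfZ sqrrN expr1n mul1r. Qed.

Lemma qfB M x y : qf M (x - y) = qf M x - sbf M x y + qf M y.
Proof. by rewrite qfD qfN sbfC -scaleN1r sbfZl mulN1r sbfC. Qed.

Lemma qf_parallelogram M x y :
  qf M (x + y) + qf M (x - y) = 2 * qf M x + 2 * qf M y.
Proof. by rewrite qfD qfB; ring. Qed.

Lemma qf_mulmx M A x : qf M (A *m x) = qf (A^T *m M *m A) x.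
Proof. by rewrite /qf trmx_mul !mulmxA. Qed.

Lemma sqn_qf x : sqn x = qf 1%:M x.
Proof.
rewrite /qf mulmx1 mxE; apply: eq_bigr => i _; by rewrite mxE.
Qed.

Lemma qf_le M : exists2 K : R, 0 <= K & forall x, qf M x <= K * sqn x.
Proof.
exists (\sum_i \sum_j `|M i j|).
  by apply: sumr_ge0 => i _; apply: sumr_ge0 => j _.
move=> x; rewrite qfE mulr_suml; apply: ler_sum => i _.
rewrite mulr_suml; apply: ler_sum => j _.
have sq_le k : x k 0 ^+ 2 <= sqn x.
  by rewrite /sqn (bigD1 k)//= lerDl sumr_ge0// => l _; exact: sqr_ge0.
have : `|x i 0 * x j 0| <= sqn x.
  have := sq_le i; have := sq_le j; rewrite ler_norml.
  have := sqr_ge0 (x i 0 - x j 0); have := sqr_ge0 (x i 0 + x j 0).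
  by move=> *; apply/andP; split; nra.
move=> h; apply: le_trans (ler_norm _) _.
by rewrite mulrAC mulrC normrM ler_wpM2l.
Qed.

Definition posdef M := forall x, x != 0 -> 0 < qf M x.

Lemma posdef_ge0 M x : posdef M -> 0 <= qf M x.
Proof.
by move=> pM; have [->|/pM/ltW//] := eqVneq x 0; rewrite qf0.
Qed.

(** The factor 4 comes from [sbf] being twice an inner product. The form is evaluated at a multiple
    of the point of the line [x + t y] where it is minimal. *)
Lemma posdef_cauchy_schwarz M x y : posdef M ->
  sbf M x y ^+ 2 <= 4 * qf M x * qf M y.
Proof.
move=> pM; have [->|y0] := eqVneq y 0.
  by rewrite sbfC -(scale0r 0) sbfZl mul0r expr0n/= qfZ expr0n/= mul0r mulr0.
have qy := pM _ y0.
have := posdef_ge0 ((2 * qf M y) *: x - (sbf M x y) *: y) pM.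
rewrite qfB sbfZl !qfZ sbfC sbfZl [sbf M y x]sbfC.
have -> : (2 * qf M y) ^+ 2 * qf M x - 2 * qf M y * (sbf M x y * sbf M x y) +
  sbf M x y ^+ 2 * qf M y = qf M y * (4 * qf M x * qf M y - sbf M x y ^+ 2) by ring.
by rewrite pmulr_rge0// subr_ge0.
Qed.

(** Compactness of the sphere is avoided: [M + M^T] is invertible, so each coordinate of [x] is
    [sbf M (w i) x] for a fixed vector [w i], and Cauchy-Schwarz bounds its square by
    [4 * qf M (w i) * qf M x]. Using [K + 1] instead of [K] covers dimension 0, where [K = 0]. *)
Lemma posdef_lower_bound M : posdef M ->
  exists2 nu : R, 0 < nu & forall x, nu * sqn x <= qf M x.
Proof.
move=> pM; pose S := M + M^T.
have SE x y : sbf M x y = (x^T *m S *m y) 0 0.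
  rewrite /sbf /S mulmxDr mulmxDl [RHS]mxE; congr (_ + _).
  rewrite -[in LHS](trmxK (y^T *m M *m x)) mxE.
  by rewrite !trmx_mul trmxK mulmxA.
have uS : S \in unitmx.
  rewrite -row_free_unit; apply: inj_row_free => v vS.
  apply/eqP; apply/negPn/negP => v0.
  have vT0 : v^T != 0 by rewrite -(inj_eq trmx_inj) trmxK trmx0.
  have := pM _ vT0.
  have : sbf M v^T v^T = 0 by rewrite SE trmxK vS mul0mx mxE.
  by rewrite /sbf /qf => h; lra.
pose w i : 'cV[R]_n := (row i (invmx S))^T.
have xw x i : x i 0 = sbf M (w i) x.
  rewrite SE /w trmxK -row_mul mulVmx// -row_mul mul1mx mxE //.
pose K := \sum_i 4 * qf M (w i).
have K0 : 0 <= K by apply: sumr_ge0 => i _; rewrite mulr_ge0// posdef_ge0.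
exists (K + 1)^-1; first by rewrite invr_gt0; lra.
move=> x; rewrite mulrC ler_pdivrMr; last lra.
have : sqn x <= K * qf M x.
  rewrite /sqn /K mulr_suml; apply: ler_sum => i _.
  by rewrite xw; exact: posdef_cauchy_schwarz.
by have := posdef_ge0 x pM; nra.
Qed.

End quadratic_forms.

Section measurable_qf.
Context {R : realType} {n : nat} d (U : measurableType d).
Implicit Types f g : U -> 'cV[R]_n.

Lemma measurable_fun_cV_coord f i : measurable_fun [set: U] f ->
  measurable_fun [set: U] (fun u => f u i 0).
Proof. by move=> mf; apply: measurableT_comp (measurable_cV_coord i) mf. Qed.

Lemma measurable_fun_cVD f g : measurable_fun [set: U] f ->
  measurable_fun [set: U] g -> measurable_fun [set: U] (fun u => f u + g u).
Proof.
move=> mf mg; apply: measurable_fun_cVP => i; under eq_fun do rewrite mxE.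
by apply: measurable_funD; exact: measurable_fun_cV_coord.
Qed.

Lemma measurable_fun_cVB f g : measurable_fun [set: U] f ->
  measurable_fun [set: U] g -> measurable_fun [set: U] (fun u => f u - g u).
Proof.
move=> mf mg; apply: measurable_fun_cVP => i; under eq_fun do rewrite !mxE.
by apply: measurable_funB; exact: measurable_fun_cV_coord.
Qed.

Lemma measurable_fun_mulmx (A : 'M[R]_n) f : measurable_fun [set: U] f ->
  measurable_fun [set: U] (fun u => A *m f u).
Proof.
move=> mf; apply: measurable_fun_cVP => i; under eq_fun do rewrite !mxE.
apply: measurable_sum => j; apply: measurable_funM => //.
exact: measurable_fun_cV_coord.
Qed.

Lemma measurable_fun_qf (M : 'M[R]_n) f : measurable_fun [set: U] f ->
  measurable_fun [set: U] (fun u => qf M (f u)).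
Proof.
move=> mf; under eq_fun do rewrite qfE.
apply: measurable_sum => i; apply: measurable_sum => j.
by apply: measurable_funM; [apply: measurable_funM => //|];
  exact: measurable_fun_cV_coord.
Qed.

End measurable_qf.

Section continuous_real.
Context {R : realType} (T : topologicalType).
Implicit Types f g : T -> R.

Lemma continuous_funD f g : continuous f -> continuous g ->
  continuous (fun x => f x + g x).
Proof. by move=> cf cg x; apply: cvgD; [exact: cf|exact: cg]. Qed.

Lemma continuous_funM f g : continuous f -> continuous g ->
  continuous (fun x => f x * g x).
Proof. by move=> cf cg x; apply: cvgM; [exact: cf|exact: cg]. Qed.

Lemma continuous_fun_comp (g : R -> R) f : continuous g -> continuous f ->
  continuous (fun x => g (f x)).
Proof. by move=> cg cf x; apply: continuous_comp; [exact: cf|exact: cg]. Qed.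

Lemma continuous_funV f : (forall x, f x != 0) -> continuous f ->
  continuous (fun x => (f x)^-1).
Proof. by move=> f0 cf x; apply: cvgV; [exact: f0|exact: cf]. Qed.

Lemma continuous_fun_sum (I : Type) (r : seq I) (F : I -> T -> R) :
  (forall i, continuous (F i)) -> continuous (fun x => \sum_(i <- r) F i x).
Proof.
move=> cF; elim: r => [|i r IH].
  by under eq_fun do rewrite big_nil; exact: cst_continuous.
by under eq_fun do rewrite big_cons; exact: continuous_funD.
Qed.

Lemma continuous_fun_prod (I : Type) (r : seq I) (F : I -> T -> R) :
  (forall i, continuous (F i)) -> continuous (fun x => \prod_(i <- r) F i x).
Proof.
move=> cF; elim: r => [|i r IH].
  by under eq_fun do rewrite big_nil; exact: cst_continuous.
by under eq_fun do rewrite big_cons; exact: continuous_funM.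
Qed.

End continuous_real.

Lemma continuous_translate {R : realType} (V : normedModType R) (v : V)
    (f : V -> R) : continuous f -> continuous (fun x => f (x + v)).
Proof.
move=> cf x; apply: (@continuous_comp _ _ _ (fun x => x + v)); last exact: cf.
by apply: cvgD; [exact: cvg_id|exact: cvg_cst].
Qed.

Lemma continuous_qf {R : realType} n (M : 'M[R]_n) : continuous (qf M).
Proof.
rewrite (_ : qf M = fun x => \sum_i \sum_j x i 0 * M i j * x j 0); last first.
  by apply/funext => x; exact: qfE.
apply: continuous_fun_sum => i; apply: continuous_fun_sum => j.
apply: continuous_funM; last exact: coord_continuous.
by apply: continuous_funM; [exact: coord_continuous|exact: cst_continuous].
Qed.

(** [gaussian S] is a constant times [gexp (invmx S)]. The constant is kept apart because its being
    nonzero has to be derived. *)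
Definition gexp {R : realType} n (M : 'M[R]_n) (x : 'cV[R]_n) : R :=
  expR (- 2^-1 * qf M x).

Lemma measurable_gexp {R : realType} n (M : 'M[R]_n) d (U : measurableType d)
    (f : U -> 'cV[R]_n) : measurable_fun [set: U] f ->
  measurable_fun [set: U] (fun u => gexp M (f u)).
Proof.
move=> mf; rewrite /gexp; apply: measurableT_comp => //; apply: measurable_funM => //.
exact: measurable_fun_qf.
Qed.

Lemma cvg_inv_sqr {R : realType} (a b : R) : b != 0 ->
  (1 + (a + k%:R * b) ^+ 2)^-1 @[k --> \oo] --> 0.
Proof.
move=> b0; apply/cvgrPdist_lt => e e0; near=> k.
rewrite sub0r normrN ger0_norm; last by rewrite invr_ge0 addr_ge0// sqr_ge0.
have b0' : 0 < `|b| by rewrite normr_gt0.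
have : (e^-1 + `|a|) / `|b| < k%:R by near: k; exact: nbhs_infty_gtr.
rewrite ltr_pdivrMr// => h.
have le1 : k%:R * `|b| - `|a| <= `|a + k%:R * b|.
  have -> : k%:R * `|b| = `|a + k%:R * b - a|.
    by rewrite addrAC subrr add0r normrM [`|k%:R|]ger0_norm.
  by rewrite lerBlDr ler_normB.
have le2 : e^-1 < `|a + k%:R * b| by lra.
rewrite -[ltRHS]invrK ltf_pV2 ?posrE ?invr_gt0//; last first.
  by rewrite ltr_wpDr// sqr_ge0.
rewrite -real_normK ?num_real//; nra.
Unshelve. all: by end_near. Qed.

(* If [qf M h <= 0] then [gexp M x] is bounded by the sum of the values of [gexp M]
   at [x + k h] and [x - k h]; integrated against a fixed weight, both of these
   tend to 0 as k grows. *)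
Lemma integrable_gexp_posdef {R : realType} n (M : 'M[R]_n) :
  (\int[lebesgue_cV n]_x (gexp M x)%:E < +oo)%E ->
  (\int[lebesgue_cV n]_x (gexp M x)%:E)%E != 0%E -> posdef M.
Proof.
move=> foo fn0 h h0; rewrite ltNge; apply/negP => hle0; move/eqP: fn0; apply.
have [i hi] : exists i, h i 0 != 0.
  apply/existsP; rewrite -negb_forall; apply: contra h0 => /forallP h0.
  by apply/eqP/colP => i; rewrite mxE; apply/eqP.
pose f (x : 'cV[R]_n) := gexp M x.
have f0 x : 0 <= f x by exact: expR_ge0.
have mf : measurable_fun [set: 'cV[R]_n] f by exact: measurable_gexp.
(* A weight that tends to 0 along [x + k h], as [h i 0] is nonzero, and that is strictly positive,
   so that the vanishing of the integral of [f * chi] forces that of the integral of [f]. *)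
pose chi (x : 'cV[R]_n) : R := (1 + x i 0 ^+ 2)^-1.
have chi_gt0 x : 0 < chi x by rewrite invr_gt0 ltr_wpDr// sqr_ge0.
have chi_ge0 x : 0 <= chi x by exact: ltW.
have chi_le1 x : chi x <= 1 by rewrite invf_le1 ?lerDl ?sqr_ge0// ltr_wpDr// sqr_ge0.
have mchi : measurable_fun [set: 'cV[R]_n] chi.
  pose inv (y : R) := (1 + y ^+ 2)^-1.
  have minv : measurable_fun [set: R] inv.
    apply: continuous_measurable_fun => y; apply: cvgV; last first.
      by apply: cvgD; [exact: cvg_cst|exact: exprn_continuous].
    by rewrite gt_eqF// ltr_wpDr// sqr_ge0.
  by apply: (measurableT_comp minv); exact: measurable_cV_coord.
have fle x k : f x <= f (x + k *: h) + f (x - k *: h).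
  have := qf_parallelogram M x (k *: h); rewrite qfZ => E.
  have k2 : k ^+ 2 * qf M h <= 0 by rewrite mulr_ge0_le0// sqr_ge0.
  have [le|gt] := leP (qf M (x + k *: h)) (qf M x).
    by rewrite ler_wpDr// ler_expR; lra.
  by rewrite ler_wpDl// ler_expR; lra.
pose I (e : R) k := (\int[lebesgue_cV n]_x (f x * chi (x + (e * k%:R) *: h))%:E)%E.
have Icvg e : e != 0 -> I e k @[k --> \oo] --> 0%E.
  move=> e0.
  have -> : 0%E = (\int[lebesgue_cV n]_x (@cst 'cV[R]_n _ 0 x)%:E)%E
    by rewrite (integral0 (lebesgue_cV n) setT).
  apply: (dominated_cvg_EFin (g := f)).
  - move=> k; apply: measurable_funM => //.
    by apply: measurableT_comp => //; exact: measurable_cVD.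
  - move=> x; rewrite -[X in _ --> X](mulr0 (f x)); apply: cvgM; first exact: cvg_cst.
    have := @cvg_inv_sqr R (x i 0) (e * h i 0).
    rewrite mulf_neq0// => /(_ isT); apply: cvg_trans; apply: near_eq_cvg.
    by apply: nearW => k /=; rewrite /chi !mxE mulrA [_ * e]mulrC.
  - apply/integrableP; split; first exact/measurable_EFinP.
    by under eq_integral do rewrite /= ger0_norm//.
  - move=> k x; rewrite ger0_norm; last by rewrite mulr_ge0.
    by rewrite ler_piMr.
have mtr (v : 'cV[R]_n) :
    measurable_fun [set: 'cV[R]_n] (fun x => (f (x - v) * chi x)%:E).
  apply/measurable_EFinP/measurable_funM => //.
  by apply: measurableT_comp => //; exact: measurable_cVD.
have fchi0 x v : 0 <= f (x - v) * chi x by rewrite mulr_ge0.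
have mfchi : measurable_fun [set: 'cV[R]_n] (fun x => (f x * chi x)%:E).
  by apply/measurable_EFinP; exact: measurable_funM.
(* A translation moves the shift from [f] to the weight, where [f] itself is the majorant for
   dominated convergence. *)
have le k : (\int[lebesgue_cV n]_x (f x * chi x)%:E <= I (-1)%R k + I 1%R k)%E.
  have tr (e : R) : I e k = (\int[lebesgue_cV n]_x (f (x - (e * k%:R) *: h) * chi x)%:E)%E.
    have /= <- := integral_translate ((e * k%:R) *: h) (mtr ((e * k%:R) *: h)).
    by apply: eq_integral => x _; rewrite addrK.
  rewrite !tr -ge0_integralD//; last 2 first.
  - by move=> x _; rewrite lee_fin.
  - by move=> x _; rewrite lee_fin.
  apply: ge0_le_integral => //.
  - by move=> x _; rewrite lee_fin mulr_ge0.
  - by apply: emeasurable_funD; exact: mtr.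
  - move=> x _; rewrite -EFinD lee_fin -mulrDl ler_wpM2r ?chi_ge0//.
    by rewrite !mul1r mulN1r scaleNr opprK.
have int0 : (\int[lebesgue_cV n]_x (f x * chi x)%:E = 0)%E.
  apply/eqP; rewrite eq_le integral_ge0 ?andbT; last first.
    by move=> x _; rewrite lee_fin mulr_ge0.
  have N1 : (-1 : R) != 0 by rewrite oppr_eq0 oner_eq0.
  have cvI : (I (-1)%R k + I 1%R k)%E @[k --> \oo] --> (0 + 0)%E.
    by apply: cvgeD; [by []|exact: Icvg|apply: Icvg; exact: oner_neq0].
  rewrite adde0 in cvI.
  by apply: cvge_ge cvI; apply: nearW => k; exact: le.
have /ae_eq_integral_abs : (\int[lebesgue_cV n]_x `|(f x * chi x)%:E| = 0)%E.
  under eq_integral do rewrite gee0_abs ?lee_fin ?mulr_ge0//.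
  by [].
move=> /(_ measurableT mfchi) ae0.
rewrite -(integral0 (lebesgue_cV n) setT); apply: ae_eq_integral => //.
  exact/measurable_EFinP.
apply: filterS ae0 => x /= /(_ Logic.I)[] /eqP.
by rewrite mulf_eq0 [chi x == 0]gt_eqF// orbF => /eqP; rewrite /f => ->.
Qed.

(* [expR (- jform x z / 2)] is, up to a constant, the density of x conditionally on
   [A x - y = z], for x of density [gexp N] and y of density [gexp M]; that z again
   has density [gexp N] forces [jform] to be nonnegative. *)
Section joint_form.
Context {R : realType} {n : nat}.
Variables (M N A : 'M[R]_n).
Implicit Types x z : 'cV[R]_n.

Definition jform x z := qf M (A *m x - z) + qf N x - qf N z.

Lemma jform_parallelogram x z x' z' :
  jform (x + x') (z + z') + jform (x - x') (z - z') =
  2 * jform x z + 2 * jform x' z'.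
Proof.
rewrite /jform mulmxDr mulmxBr.
have E1 : A *m x + A *m x' - (z + z') = (A *m x - z) + (A *m x' - z').
  by rewrite opprD addrACA.
have E2 : A *m x - A *m x' - (z - z') = (A *m x - z) - (A *m x' - z').
  by rewrite !opprB addrACA [RHS]addrACA; congr (_ + _); exact: addrC.
have := qf_parallelogram M (A *m x - z) (A *m x' - z').
have := qf_parallelogram N x x'; have := qf_parallelogram N z z'.
by rewrite E1 E2; lra.
Qed.

(** The right-hand side is minus the exponent of [gexp M (A x - z) ^+ 2 * gexp N x / gexp N z], the
    Lebesgue density of the squared kernel up to polynomial factors. *)
Lemma posdef_joint_form : posdef M -> posdef N ->
  (forall x z, 0 <= jform x z) ->
  exists2 e : R, 0 < e & forall x z,
    e * (sqn x + sqn z) <= 2^-1 * qf M (A *m x - z) + 2^-1 * jform x z.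
Proof.
move=> pM pN J0.
have [m m0 Mm] := posdef_lower_bound pM.
have [nu nu0 Nnu] := posdef_lower_bound pN.
have [K K0 MK] := qf_le (A^T *m M *m A).
have [K' K'0 AK'] := qf_le (A^T *m 1%:M *m A).
pose kap := K / nu.
have kap0 : 0 <= kap by rewrite divr_ge0// ltW.
have MA x : qf M (A *m x) <= kap * qf N x.
  rewrite qf_mulmx (le_trans (MK x))// /kap -mulrA ler_wpM2l//.
  by rewrite mulrC ler_pdivlMr// mulrC.
(* Replacing [x] by [x - eta x] in [jform] gains [2 * eta * qf N x] to first order; the terms of
   second order cost at most [eta ^+ 2 * (1 + 3 * kap) * qf N x]. This [eta] makes the cost half of
   the gain. *)
pose eta := (1 + 3 * kap)^-1.
have eta0 : 0 < eta by rewrite invr_gt0; nra.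
have etaE : eta * (1 + 3 * kap) = 1 by rewrite mulVf// gt_eqF//; nra.
have eta1 : eta <= 1 by nra.
have low x z : 4^-1 * qf M (A *m x - z) + 2^-1 * eta * qf N x <=
    2^-1 * qf M (A *m x - z) + 2^-1 * jform x z.
  (* The margin in x comes from the nonnegativity of jform at a nearby point. *)
  have := J0 (x - eta *: x) z; rewrite {1}/jform.
  have -> : A *m (x - eta *: x) - z = (A *m x - z) - eta *: (A *m x).
    by rewrite mulmxBr -scalemxAr addrAC.
  have -> : qf N (x - eta *: x) = (1 - eta) ^+ 2 * qf N x.
    by rewrite -qfZ scalerBl scale1r.
  rewrite /jform; move: (A *m x - z) => y.
  have := posdef_ge0 (y + 2 *: (eta *: (A *m x))) pM.
  rewrite (qfD M y) (qfB M y) !sbfZr !qfZ.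
  set s := sbf M y _; set My := qf M y; set Nx := qf N x; set Nz := qf N z.
  have := MA x; rewrite -/Nx; set MAx := qf M (A *m x) => hMA h1 h2.
  have Nx0 : 0 <= Nx by exact: posdef_ge0.
  have h3 : eta ^+ 2 * MAx <= eta ^+ 2 * (kap * Nx) by rewrite ler_wpM2l// sqr_ge0.
  have h4 : eta ^+ 2 * (1 + 3 * kap) = eta by rewrite expr2 -mulrA etaE mulr1.
  have h5 : eta ^+ 2 * (kap * Nx) * 3 = eta * Nx - eta ^+ 2 * Nx.
    by transitivity (eta ^+ 2 * (1 + 3 * kap) * Nx - eta ^+ 2 * Nx); [ring|rewrite h4].
  by lra.
(* As [z] is the difference of [A x] and [A x - z], a bound on [x] and on [A x - z] also controls
   [z]. *)
have sq2 x z : sqn z <= 2 * (K' * sqn x) + 2 * sqn (A *m x - z).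
  have := AK' x; rewrite -qf_mulmx -sqn_qf => h.
  have := qf_parallelogram 1%:M (A *m x) (A *m x - z).
  rewrite -!sqn_qf => h'.
  have E : A *m x - (A *m x - z) = z by rewrite opprB addrCA subrr addr0.
  have := sqn_ge0 (A *m x + (A *m x - z)); rewrite E in h'; lra.
pose del := Num.min (4^-1 * m) (2^-1 * eta * nu).
have del0 : 0 < del by rewrite lt_min !mulr_gt0// ?invr_gt0.
have d1 : del <= 4^-1 * m by rewrite ge_min lexx.
have d2 : del <= 2^-1 * eta * nu by rewrite ge_min lexx orbT.
exists (del / (3 + 2 * K')).
  by rewrite divr_gt0//; lra.
move=> x z; apply: le_trans (low x z).
rewrite mulrAC ler_pdivrMr; last lra.
have h1 : del * sqn (A *m x - z) <= 4^-1 * qf M (A *m x - z).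
  by have := Mm (A *m x - z); have := sqn_ge0 (A *m x - z); nra.
have h2 : del * sqn x <= 2^-1 * eta * qf N x.
  have h : 2^-1 * eta * (nu * sqn x) <= 2^-1 * eta * qf N x.
    by rewrite ler_wpM2l// mulr_ge0// ltW.
  by have := sqn_ge0 x; nra.
have h3 := sq2 x z.
have sx := sqn_ge0 x; have sy := sqn_ge0 (A *m x - z).
have h4 : sqn x + sqn z <= (sqn x + sqn (A *m x - z)) * (3 + 2 * K') by nra.
apply: (@le_trans _ _ (del * ((sqn x + sqn (A *m x - z)) * (3 + 2 * K')))).
  by rewrite ler_wpM2l// ltW.
by rewrite mulrA; apply: ler_wpM2r; lra.
Qed.

End joint_form.

Lemma continuous_gexp {R : realType} n (M : 'M[R]_n) : continuous (gexp M).
Proof.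
apply: continuous_fun_comp; first exact: continuous_expR.
by apply: continuous_funM; [exact: cst_continuous|exact: continuous_qf].
Qed.

Lemma gexp_gt0 {R : realType} n (M : 'M[R]_n) x : 0 < gexp M x.
Proof. exact: expR_gt0. Qed.

Lemma gexp_ge0 {R : realType} n (M : 'M[R]_n) x : 0 <= gexp M x.
Proof. exact: expR_ge0. Qed.

Lemma gexp_le1 {R : realType} n (M : 'M[R]_n) x : posdef M -> gexp M x <= 1.
Proof.
by move=> /(posdef_ge0 x) h; rewrite /gexp -[leRHS]expR0 ler_expR; lra.
Qed.

Lemma ge0_le_integralZD d (T : measurableType d) (R : realType)
    (P : {measure set T -> \bar R}) (f g h : T -> \bar R) (k : R) :
  measurable_fun [set: T] f -> measurable_fun [set: T] g ->
  measurable_fun [set: T] h -> (forall x, 0 <= f x)%E -> (forall x, 0 <= g x)%E ->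
  (forall x, 0 <= h x)%E -> 0 <= k -> (forall x, k%:E * h x <= f x + g x)%E ->
  (k%:E * \int[P]_x h x <= \int[P]_x f x + \int[P]_x g x)%E.
Proof.
move=> mf mg mh f0 g0 h0 k0 le.
rewrite -ge0_integralD// -ge0_integralZl//.
apply: ge0_le_integral => //.
- by move=> x _; rewrite mule_ge0.
- exact: emeasurable_funM.
- exact: emeasurable_funD.
Qed.

Section joint_form_ge0.
Context {R : realType} {n : nat}.
Variables (M N A : 'M[R]_n) (c : R).
Hypotheses (c0 : 0 < c) (pN : posdef N).
Hypothesis Noo : (\int[lebesgue_cV n]_x (gexp N x)%:E < +oo)%E.
Hypothesis N0 : (\int[lebesgue_cV n]_x (gexp N x)%:E)%E != 0%E.
Hypothesis inv : forall f : 'cV[R]_n -> R, continuous f ->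
  (exists K, forall x, `|f x| <= K) -> (forall x, 0 <= f x) ->
  (\int[lebesgue_cV n]_x \int[lebesgue_cV n]_z
    (c * gexp M (A *m x - z) * gexp N x * f z)%:E =
   \int[lebesgue_cV n]_z (f z * gexp N z)%:E)%E.

Let J := jform M N A.
Let chi (z : 'cV[R]_n) : R := gexp N z ^+ 2.
Let Phi (x1 z1 : 'cV[R]_n) := (\int[lebesgue_cV n]_x \int[lebesgue_cV n]_z
    (expR (- 2^-1 * J (x + x1) (z + z1)) * chi z)%:E)%E.
Let X := (\int[lebesgue_cV n]_z (chi z)%:E)%E.

Let mJ d (U : measurableType d) (f g : U -> 'cV[R]_n) :
  measurable_fun [set: U] f -> measurable_fun [set: U] g ->
  measurable_fun [set: U] (fun u => expR (- 2^-1 * J (f u) (g u))).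
Proof.
move=> mf mg; apply: measurableT_comp => //; apply: measurable_funM => //.
apply: measurable_funB; last exact: measurable_fun_qf.
apply: measurable_funD; apply: measurable_fun_qf => //.
by apply: measurable_fun_cVB => //; exact: measurable_fun_mulmx.
Qed.

Let mchi d (U : measurableType d) (f : U -> 'cV[R]_n) :
  measurable_fun [set: U] f -> measurable_fun [set: U] (fun u => chi (f u)).
Proof. by move=> mf; apply: measurable_funX; exact: measurable_gexp. Qed.

Let chi0 z : 0 <= chi z. Proof. exact: sqr_ge0. Qed.

Let PhiE x1 z1 : (c%:E * Phi x1 z1 = X)%E.
Proof.
(* The square in [chi] keeps this test function bounded. *)
pose f z := chi (z - z1) / gexp N z.
have fE z : f z * gexp N z = chi (z - z1) by rewrite /f divfK// gt_eqF// gexp_gt0.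
have cf : continuous f.
  apply: continuous_funM.
    apply: (continuous_translate (f := chi)).
    apply: (continuous_fun_comp (g := fun t => t ^+ 2)); first exact: exprn_continuous.
    exact: continuous_gexp.
  by apply: continuous_funV => [x|]; [rewrite gt_eqF// gexp_gt0|exact: continuous_gexp].
have f0 z : 0 <= f z by rewrite divr_ge0// gexp_ge0.
have bf : exists K, forall x, `|f x| <= K.
  (* The parallelogram identity for [z - z1] and [z1] bounds [2^-1 * qf N z - qf N (z - z1)] by
     [qf N z1]. *)
  exists (expR (qf N z1)) => z; rewrite ger0_norm//.
  rewrite /f /chi /gexp -expRM_natl -expRN -expRD ler_expR.
  have := qf_parallelogram N (z - z1) z1; rewrite subrK.
  by have := posdef_ge0 (z - z1 - z1) pN; lra.
have := inv cf bf f0.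
under [RHS]eq_integral do rewrite fE.
rewrite (integral_translate (- z1) (f := fun z => (chi z)%:E)); last first.
  by apply/measurable_EFinP; exact: mchi.
rewrite -/X => <-.
pose h (p : 'cV[R]_n * 'cV[R]_n) :=
  (c * gexp M (A *m p.1 - p.2) * gexp N p.1 * f p.2)%:E.
have mh : measurable_fun [set: 'cV[R]_n * 'cV[R]_n] h.
  apply/measurable_EFinP/measurable_funM; last first.
    exact: measurableT_comp (continuous_measurable_cV cf) measurable_snd.
  apply: measurable_funM; last by apply: measurable_gexp; exact: measurable_fst.
  apply: measurable_funM => //; apply: measurable_gexp; apply: measurable_fun_cVB => //.
  exact: measurable_fun_mulmx.
have h0 p : (0 <= h p)%E.
  rewrite lee_fin; apply: mulr_ge0 => //; apply: mulr_ge0; last exact: gexp_ge0.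
  by apply: mulr_ge0; [exact: ltW|exact: gexp_ge0].
pose H x := (\int[lebesgue_cV n]_z h (x, z))%E.
have mH : measurable_fun [set: 'cV[R]_n] H by exact: measurable_fun_fubini_tonelli_F.
pose e (p : 'cV[R]_n * 'cV[R]_n) :=
  (expR (- 2^-1 * J (p.1 + x1) (p.2 + z1)) * chi p.2)%:E.
have me : measurable_fun [set: 'cV[R]_n * 'cV[R]_n] e.
  apply/measurable_EFinP/measurable_funM; last by apply: mchi; exact: measurable_snd.
  by apply: mJ; apply: measurable_fun_cVD.
have e0 p : (0 <= e p)%E by rewrite lee_fin mulr_ge0// expR_ge0.
rewrite -(integral_translate x1 (f := H))//.
rewrite -ge0_integralZl//; last 3 first.
- exact: (measurable_fun_fubini_tonelli_F e).
- by move=> x _; apply: integral_ge0 => z _; exact: (e0 (x, z)).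
- by rewrite lee_fin ltW.
apply: eq_integral => x _.
rewrite /H -(integral_translate z1 (f := fun z => h (x + x1, z)))//; last first.
  exact: measurableT_comp mh (measurable_fun_pair _ _).
rewrite -ge0_integralZl//; last 3 first.
- exact: measurableT_comp me (measurable_fun_pair _ _).
- by move=> z _; exact: (e0 (x, z)).
- by rewrite lee_fin ltW.
apply: eq_integral => z _.
rewrite -EFinM /h /= /f addrK; congr EFin.
have -> : expR (- 2^-1 * J (x + x1) (z + z1)) = gexp M (A *m (x + x1) - (z + z1)) *
    gexp N (x + x1) * (gexp N (z + z1))^-1.
  by rewrite /gexp -expRN -!expRD /J /jform; congr expR; ring.
by ring.
Qed.

(* [c * Phi x1 z1] does not depend on (x1, z1), whereas by the parallelogram identity
   [Phi w + Phi (- w)] is at least [2 expR (- J w / 2) * Phi 0]. *)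
Lemma joint_form_ge0 x0 z0 : 0 <= J x0 z0.
Proof.
have X0 : (0 < X)%E.
  rewrite lt0e integral_ge0 ?andbT; last by move=> z _; rewrite lee_fin.
  apply: contra N0 => /eqP intchi0; apply/eqP.
  have mchi' : measurable_fun [set: 'cV[R]_n] (fun z => (chi z)%:E).
    by apply/measurable_EFinP; exact: mchi.
  have /ae_eq_integral_abs : (\int[lebesgue_cV n]_z `|(chi z)%:E| = 0)%E.
    by under eq_integral do rewrite gee0_abs ?lee_fin//.
  move=> /(_ measurableT mchi') ae0.
  rewrite -(integral0 (lebesgue_cV n) setT); apply: ae_eq_integral => //.
    by apply/measurable_EFinP; exact: measurable_gexp.
  apply: filterS ae0 => x /= /(_ Logic.I)[] /eqP.
  by rewrite sqrf_eq0 gt_eqF// gexp_gt0.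
have Xfin : X \is a fin_num.
  rewrite ge0_fin_numE ?(ltW X0)//; apply: le_lt_trans Noo.
  apply: ge0_le_integral => //.
  - by move=> z _; rewrite lee_fin.
  - by apply/measurable_EFinP; exact: mchi.
  - by apply/measurable_EFinP; exact: measurable_gexp.
  - move=> z _; rewrite lee_fin /chi expr2 ler_piMl ?gexp_ge0//.
    exact: gexp_le1.
pose e (x1 z1 : 'cV[R]_n) (p : 'cV[R]_n * 'cV[R]_n) :=
  (expR (- 2^-1 * J (p.1 + x1) (p.2 + z1)) * chi p.2)%:E.
have me x1 z1 : measurable_fun [set: 'cV[R]_n * 'cV[R]_n] (e x1 z1).
  apply/measurable_EFinP/measurable_funM; last by apply: mchi; exact: measurable_snd.
  by apply: mJ; apply: measurable_fun_cVD.
have e0 x1 z1 p : (0 <= e x1 z1 p)%E by rewrite lee_fin mulr_ge0// expR_ge0.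
have PhiP x1 z1 : Phi x1 z1 = (\int[(lebesgue_cV n \x lebesgue_cV n)%E]_p e x1 z1 p)%E.
  by rewrite fubini_tonelli1.
set k := expR (- 2^-1 * J x0 z0).
have key : ((2 * k)%:E * Phi 0 0 <= Phi x0 z0 + Phi (- x0) (- z0))%E.
  rewrite !PhiP; apply: ge0_le_integralZD => //.
    by rewrite mulr_ge0// expR_ge0.
  move=> [x z]; rewrite /e/= -EFinM -EFinD lee_fin -mulrDl mulrA ler_wpM2r//.
  rewrite !addr0; have := jform_parallelogram M N A x z x0 z0.
    rewrite -/(J _ _) -/(J (x - _) _) -/(J x _) -/(J x0 _) => E.
    have -> : 2 * k * expR (- 2^-1 * J x z) = 2 *
        (expR (- 4^-1 * J (x + x0) (z + z0)) * expR (- 4^-1 * J (x - x0) (z - z0))).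
      by rewrite /k -mulrA -!expRD; congr (_ * expR _); lra.
    (* The inequality [2 a b <= a ^ 2 + b ^ 2] is applied to the square roots of the two
       exponentials, whose product the parallelogram identity evaluates. *)
    have sq a : expR (- 2^-1 * a) = expR (- 4^-1 * a) ^+ 2.
      by rewrite -expRM_natl; congr expR; field.
    rewrite !sq.
    set a := expR (- 4^-1 * J (x + x0) _); set b := expR (- 4^-1 * J (x - x0) _).
    by have := sqr_ge0 (a - b); rewrite sqrrB; lra.
have Phi0 x1 z1 : (0 <= Phi x1 z1)%E by rewrite PhiP integral_ge0.
have [r Xr] : exists r, X = r%:E by exists (fine X); rewrite fineK.
have r0 : 0 < r by rewrite -lte_fin -Xr.
have : r * (2 * k) <= r + r.
  move: key (Phi0 x0 z0) (Phi0 (- x0) (- z0)).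
  move: (PhiE 0 0) (PhiE x0 z0) (PhiE (- x0) (- z0)).
  move: (Phi _ _) (Phi _ _) (Phi _ _) (2 * k) => p2 p1 p0 k2.
  rewrite Xr => E0 E1 E2 key p10 p20.
  rewrite -lee_fin EFinD EFinM -{1}E0 -{1}E1 -E2 -ge0_muleDr// -muleA.
  by rewrite [(p0 * _)%E]muleC lee_wpmul2l// lee_fin ltW.
move=> h; have k1 : k <= 1 by nra.
by move: k1; rewrite /k -[leRHS]expR0 ler_expR; lra.
Qed.

End joint_form_ge0.

(** * Polynomial kernels and integration by parts *)

Section directional_derivative.
Context {R : realType} (V : normedModType R).
Implicit Types (f g : V -> R) (x v : V).

(** Only directional derivatives are available on [V], not differentiability. Restricting to a line
    makes the chain rule and the mean value theorem of the real line applicable. *)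
Lemma is_derive_line f x v df t : is_derive (t *: v + x) v f df <->
  is_derive t 1 (fun h : R => f (h *: v + x)) df.
Proof.
have E : (fun h : R => h^-1 *: ((f \o shift (t *: v + x)) (h *: v) - f (t *: v + x))) =
   (fun h : R => h^-1 *: (((fun h : R => f (h *: v + x)) \o shift t) (h *: 1) -
     f (t *: v + x))).
  by apply/funext => h /=; rewrite [_%:A]mulr1 addrA -scalerDl.
by split=> -[]; rewrite /derivable /derive ?E => dr de; apply: DeriveDef;
  rewrite /derivable /derive ?E.
Qed.

Lemma is_derive_lineP f x v df :
  is_derive x v f df <-> is_derive (0 : R) 1 (fun h : R => f (h *: v + x)) df.
Proof. by rewrite -is_derive_line scale0r add0r. Qed.

Lemma is_derive_expR_comp f x v df : is_derive x v f df ->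
  is_derive x v (fun y => expR (f y)) (expR (f x) * df).
Proof.
move=> /is_derive_lineP [dr de]; apply/is_derive_lineP.
set g := fun h : R => f _ in dr de.
have dr1 : derivable g 0 1 by [].
have de1 : derivable expR (g 0) 1 by apply: ex_derive; exact: is_derive_expR.
apply: DeriveDef.
  apply/derivable1_diffP; apply: (@differentiable_comp _ _ _ _ g expR).
    exact/derivable1_diffP.
  exact/derivable1_diffP.
rewrite -derive1E (_ : (fun h => _) = expR \o g)// derive1_comp//.
by rewrite !derive1E de derive_val /g scale0r add0r.
Qed.

End directional_derivative.

Lemma is_derive_coord {R : realType} {n : nat} (i j : 'I_n) (x : 'cV[R]_n) :
  is_derive x (delta_mx i 0) (fun y : 'cV[R]_n => y j 0) ((delta_mx i 0 : 'cV[R]_n) j 0).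
Proof.
apply/is_derive_lineP.
have -> : (fun h : R => (h *: delta_mx i 0 + x) j 0) =
    (fun h : R => h * (delta_mx i 0 : 'cV[R]_n) j 0 + x j 0).
  by apply/funext => h; rewrite !mxE.
set c := (delta_mx i 0 : 'cV[R]_n) j 0; set b := x j 0.
have -> : (fun h : R => h * c + b) = (id * cst c + cst b) by [].
by apply: is_derive_eq; rewrite /= scaler0 add0r addr0 /GRing.scale/= mulr1.
Qed.

Lemma norm_le_expR {R : realType} (d x : R) : 0 < d ->
  `|x| <= (2 * d)^-1 * expR (2 * d * `|x|).
Proof.
move=> d0; have d2 : 0 < 2 * d by lra.
rewrite -ler_pdivrMl ?invr_gt0// invrK.
by have := @expR_ge1Dx R (2 * d * `|x|); lra.
Qed.

Section polynomial_kernels.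
Context {R : realType} {n : nat}.
Local Notation E := 'cV[R]_n.
Implicit Types (m p : E -> E -> R).

(** Polynomials in the entries of [x] and [z]. In this form continuity, growth and differentiation
    in [x] are proved constructor by constructor, with no normal form. *)
Inductive polyk : (E -> E -> R) -> Prop :=
| polyk_cst c : polyk (fun _ _ => c)
| polyk_l i : polyk (fun x _ => x i 0)
| polyk_r i : polyk (fun _ z => z i 0)
| polykD m p : polyk m -> polyk p -> polyk (fun x z => m x z + p x z)
| polykM m p : polyk m -> polyk p -> polyk (fun x z => m x z * p x z).

Lemma polyk_sum (I : Type) (r : seq I) (F : I -> E -> E -> R) :
  (forall i, polyk (F i)) -> polyk (fun x z => \sum_(i <- r) F i x z).
Proof.
move=> pF; elim: r => [|i r IH].
  by under eq_fun do under eq_fun do rewrite big_nil; exact: polyk_cst.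
by under eq_fun do under eq_fun do rewrite big_cons; exact: polykD.
Qed.

Lemma polyk_qf (M A : 'M[R]_n) : polyk (fun x z => qf M (A *m x - z)).
Proof.
have pc i : polyk (fun x z => (A *m x - z) i 0).
  under eq_fun do under eq_fun do rewrite !mxE -mulN1r.
  apply: polykD; last by apply: polykM; [exact: polyk_cst|exact: polyk_r].
  by apply: polyk_sum => j; apply: polykM; [exact: polyk_cst|exact: polyk_l].
under eq_fun do under eq_fun do rewrite qfE.
apply: polyk_sum => i; apply: polyk_sum => j.
apply: polykM (pc j); apply: polykM (pc i) _; exact: polyk_cst.
Qed.

Lemma polyk_measurable m : polyk m ->
  measurable_fun [set: E * E] (fun q => m q.1 q.2).
Proof.
elim=> {m} [c|i|i|m p _ mm _ mp|m p _ mm _ mp].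
- exact: measurable_cst.
- exact: measurableT_comp (measurable_cV_coord i) measurable_fst.
- exact: measurableT_comp (measurable_cV_coord i) measurable_snd.
- exact: measurable_funD.
- exact: measurable_funM.
Qed.

Lemma polyk_continuous m z : polyk m -> continuous (m^~ z).
Proof.
elim=> {m} [c|i|i|m p _ mm _ mp|m p _ mm _ mp].
- exact: cst_continuous.
- exact: coord_continuous.
- exact: cst_continuous.
- exact: continuous_funD.
- exact: continuous_funM.
Qed.

(** The rate [d] is arbitrary, so that any Gaussian decay absorbs the polynomial. In a product each
    factor takes the rate [d / 2]. *)
Lemma polyk_growth m : polyk m -> forall d : R, 0 < d ->
  exists2 C, 0 <= C & forall x z, `|m x z| <= C * expR (d * (sqn x + sqn z)).
Proof.
have sq_le (x : E) i : x i 0 ^+ 2 <= sqn x.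
  by rewrite /sqn (bigD1 i)//= lerDl sumr_ge0// => j _; exact: sqr_ge0.
have coord (d : R) (x : E) i s : 0 < d -> 0 <= s -> `|x i 0| <=
    (2 * d)^-1 * expR d * expR (d * (sqn x + s)).
  move=> d0 s0; rewrite -mulrA -expRD.
  apply: le_trans (norm_le_expR _ d0) _.
  apply: ler_wpM2l; first by rewrite invr_ge0 mulr_ge0 ?(ltW d0).
  rewrite ler_expR.
  have h : 2 * `|x i 0| <= 1 + (sqn x + s).
    have := sq_le x i; have := sqr_ge0 (`|x i 0| - 1).
    by rewrite sqrrB real_normK ?num_real//; lra.
  by have := ler_wpM2l (ltW d0) h; lra.
have coef0 (d : R) : 0 < d -> 0 <= (2 * d)^-1 * expR d.
  by move=> d0; rewrite mulr_ge0 ?expR_ge0// invr_ge0 mulr_ge0// ltW.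
elim=> {m} [c|i|i|m p _ mm _ mp|m p _ mm _ mp] d d0.
- exists `|c| => // x z; rewrite ler_peMr// -[leLHS]expR0 ler_expR.
  by apply: mulr_ge0; [exact: ltW|apply: addr_ge0; exact: sqn_ge0].
- exists ((2 * d)^-1 * expR d); first exact: coef0.
  by move=> x z; apply: coord => //; exact: sqn_ge0.
- exists ((2 * d)^-1 * expR d); first exact: coef0.
  by move=> x z; rewrite [sqn x + _]addrC; apply: coord => //; exact: sqn_ge0.
- have [C C0 hC] := mm d d0; have [D D0 hD] := mp d d0.
  exists (C + D); first exact: addr_ge0.
  move=> x z; rewrite mulrDl; apply: le_trans (ler_normD _ _) _; exact: lerD.
- have d2 : 0 < d / 2 by rewrite divr_gt0.
  have [C C0 hC] := mm _ d2; have [D D0 hD] := mp _ d2.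
  exists (C * D); first exact: mulr_ge0.
  move=> x z; have -> : d * (sqn x + sqn z) = d / 2 * (sqn x + sqn z) + d / 2 * (sqn x + sqn z) by field.
  by rewrite expRD mulrACA normrM ler_pM.
Qed.

Lemma polyk_derive m i : polyk m ->
  exists2 m', polyk m' & forall x z, is_derive x (delta_mx i 0) (m^~ z) (m' x z).
Proof.
elim=> {m} [c|j|j|m p _ [m' pm' dm] _ [p' pp' dp]|m p pm [m' pm' dm] pp [p' pp' dp]].
- by exists (fun _ _ => 0) => [|x z]; [exact: polyk_cst|exact: is_derive_cst].
- exists (fun _ _ => (delta_mx i 0 : E) j 0); first exact: polyk_cst.
  by move=> x z; exact: is_derive_coord.
- by exists (fun _ _ => 0) => [|x z]; [exact: polyk_cst|exact: is_derive_cst].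
- exists (fun x z => m' x z + p' x z); first exact: polykD.
  by move=> x z; exact: is_deriveD.
- exists (fun x z => m x z * p' x z + p x z * m' x z).
    by apply: polykD; exact: polykM.
  by move=> x z; exact: is_deriveM.
Qed.

End polynomial_kernels.

Section compact_support.
Context {R : realType} {n : nat}.
Local Notation E := 'cV[R]_n.
Implicit Types (f w phi : E -> R) (K : set E).

(** [C] is the maximum of [|f| / w] on [K]. The weight [w] is a Gaussian where integrability is
    wanted, and the density [rho] where a test function divided by [rho] has to be bounded. *)
Lemma compact_support_bound f w K : continuous f -> supported_in K f -> compact K ->
  continuous w -> (forall x, 0 < w x) -> exists2 C, 0 <= C & forall x, `|f x| <= C * w x.
Proof.
move=> cf fK cK cw w0.
have [K0|/set0P K0] := eqVneq K set0.
  by exists 0 => // x; rewrite fK ?K0// normr0 mul0r.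
pose g x := `|f x| * (w x)^-1.
have cg : continuous g.
  apply: continuous_funM; last by apply: continuous_funV => // x; rewrite gt_eqF.
  by apply: (continuous_fun_comp (g := Num.norm)) => //; exact: norm_continuous.
have [c _ cmax] := compact_EVT_max K0 cK (continuous_subspaceT cg).
have g0 x : 0 <= g x by apply: mulr_ge0 => //; rewrite invr_ge0 ltW.
exists (g c) => // x; rewrite -ler_pdivrMr//.
have [Kx|Kx] := pselect (K x); first by apply: cmax; rewrite inE.
by rewrite fK// normr0 mul0r.
Qed.

Lemma supported_in_pderiv K phi i : closed K -> supported_in K phi ->
  supported_in K (pderiv i phi).
Proof.
move=> cK phiK x Kx; rewrite /pderiv.
rewrite (_ : 'D_(delta_mx i 0) phi x = 'D_(delta_mx i 0) (cst 0) x).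
  by rewrite derive_val.
apply: near_eq_derive.
have : nbhs x (~` K) by apply: open_nbhs_nbhs; split => //; exact: closed_openC.
by apply: filterS => y; exact: phiK.
Qed.

End compact_support.

(** A derivative is a limit along the punctured neighbourhoods of 0, while dominated convergence is
    about sequences; the difference quotients are therefore sampled at [1 / (k + 1)]. *)
Lemma cvg_harmonic_dnbhs {R : realType} : harmonic @ \oo --> (0 : R)^'.
Proof.
move=> A HA; have {}HA : nbhs (0 : R) [set y | y != 0 -> A y] by exact: HA.
have /= : \forall k \near \oo, harmonic k != 0 :> R -> A (harmonic k).
  exact: (@cvg_harmonic R _ HA).
change ((\forall k \near \oo, harmonic k != 0 :> R -> A (harmonic k)) ->
  \forall k \near \oo, A (harmonic k)).
apply: filterS => k; apply.
by rewrite invr_eq0 pnatr_eq0.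
Qed.

Lemma sqn_parallelogram {R : realType} n (x y : 'cV[R]_n) :
  sqn (x + y) + sqn (x - y) = 2 * sqn x + 2 * sqn y.
Proof. by rewrite !sqn_qf qf_parallelogram. Qed.

Lemma sqnZ {R : realType} n (c : R) (x : 'cV[R]_n) : sqn (c *: x) = c ^+ 2 * sqn x.
Proof. by rewrite !sqn_qf qfZ. Qed.

Lemma sqn_delta {R : realType} n (i : 'I_n) : sqn (delta_mx i 0 : 'cV[R]_n) = 1.
Proof.
rewrite /sqn (bigD1 i)//= big1 ?mxE ?eqxx ?expr1n ?addr0// => j ji.
by rewrite mxE (negbTE ji) expr0n.
Qed.

(* The integral of a difference quotient vanishes by translation invariance; the
   Gaussian bounds allow passing to the limit. *)
Lemma integral_derive0 {R : realType} n (i : 'I_n) (psi dpsi : 'cV[R]_n -> R) (C : R) :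
  0 <= C ->
  measurable_fun [set: 'cV[R]_n] psi ->
  (forall x, is_derive x (delta_mx i 0) psi (dpsi x)) ->
  (forall x, `|psi x| <= C * expR (- (2 * sqn x))) ->
  (forall x, `|dpsi x| <= C * expR (- (2 * sqn x))) ->
  (\int[lebesgue_cV n]_x (dpsi x)%:E = 0)%E.
Proof.
move=> C0 mpsi dpsiE psiC dpsiC; pose e : 'cV[R]_n := delta_mx i 0.
have intexp (D c : R) : 0 < c ->
    (lebesgue_cV n).-integrable [set: 'cV[R]_n] (EFin \o (fun x => D * expR (- (c * sqn x)))).
  move=> c0.
  rewrite (_ : _ \o _ = fun x => D%:E * (expR (- (c * sqn x)))%:E)%E//.
  apply: integrableZl => //; apply/integrableP; split.
    by apply/measurable_EFinP; exact: measurable_expsqn.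
  under eq_integral do rewrite gee0_abs ?lee_fin ?expR_ge0//.
  exact: integral_expsqn_lty.
have ipsi : (lebesgue_cV n).-integrable [set: 'cV[R]_n] (EFin \o psi).
  apply: le_integrable (intexp C 2 _) => //; first exact/measurable_EFinP.
  move=> x _; rewrite lee_fin [leRHS]ger0_norm ?mulr_ge0 ?expR_ge0//.
pose q k x := k.+1%:R * (psi (x + k.+1%:R^-1 *: e) - psi x).
have ipsi' k : (lebesgue_cV n).-integrable [set: 'cV[R]_n]
    (fun x => (psi (x + k.+1%:R^-1 *: e))%:E).
  apply/integrableP; split.
    by apply/measurable_EFinP; apply: measurableT_comp => //; exact: measurable_cVD.
  rewrite (integral_translate _ (f := fun x => `|(psi x)%:E|)%E); last first.
    by apply: measurableT_comp => //; exact/measurable_EFinP.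
  by have /integrableP[] := ipsi.
have q0 k : (\int[lebesgue_cV n]_x (q k x)%:E = 0)%E.
  under eq_integral do rewrite /q EFinM EFinB.
  rewrite integralZl//; last exact: integrableB.
  rewrite integralB// (integral_translate _ (f := EFin \o psi)); last exact/measurable_EFinP.
  by rewrite subee ?mule0// integrable_fin_num.
have qcvg x : q k x @[k --> \oo] --> dpsi x.
  have [dr de] := dpsiE x.
  have := cvg_comp _ _ cvg_harmonic_dnbhs dr.
  rewrite -[lim _]/('D_e psi x) de; apply: cvg_trans; apply: near_eq_cvg.
  apply: nearW => k /=; rewrite /q invrK [_ + x]addrC.
  by [].
(* By the mean value theorem the quotient is a value of [dpsi] at distance at most 1 from [x]. The
   parallelogram identity then halves the Gaussian rate from 2 to 1 and produces the factor
   [expR 2]. *)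
have qle k x : `|q k x| <= C * expR 2 * expR (- (1 * sqn x)).
  have h0 : 0 < k.+1%:R^-1 :> R by rewrite invr_gt0.
  have h1 : k.+1%:R^-1 <= 1 :> R by rewrite invf_le1// ler1n.
  have dg (t : R) : is_derive t 1 (fun t : R => psi (t *: e + x)) (dpsi (t *: e + x)).
    exact: (is_derive_line psi x e (dpsi (t *: e + x)) t).1 (dpsiE _).
  have cg : {within `[0, k.+1%:R^-1], continuous (fun t : R => psi (t *: e + x))}.
    by apply: derivable_within_continuous => t _; have [dr _] := dg t.
  have [c] := MVT h0 (fun t _ => dg t) cg.
  rewrite in_itv/= scale0r add0r subr0 => /andP[c0 ch] E.
  rewrite /q [x + _]addrC E mulrCA divff ?mulr1// (le_trans (dpsiC _))//.
  rewrite -mulrA -expRD ler_wpM2l// ler_expR mul1r.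
  have := sqn_parallelogram (c *: e + x) (c *: e).
  have -> : c *: e + x - c *: e = x by rewrite addrAC subrr add0r.
  rewrite sqnZ sqn_delta mulr1.
  have := sqn_ge0 (c *: e + x + c *: e).
  have : c ^+ 2 <= 1 by rewrite expr_le1// ltW// (lt_le_trans ch).
  by lra.
have mq k : measurable_fun [set: 'cV[R]_n] (q k).
  apply: measurable_funM => //; apply: measurable_funB => //.
  by apply: measurableT_comp => //; exact: measurable_cVD.
have lim1 := dominated_cvg_EFin mq qcvg (intexp _ _ ltr01) qle.
have lim0 : (\int[lebesgue_cV n]_x (q k x)%:E)%E @[k --> \oo] --> (0 : \bar R)%E.
  by apply: cvg_near_cst; apply: nearW => k; exact: q0.
exact: cvg_unique lim1 lim0.
Qed.

Lemma continuous_expsqn {R : realType} n (c : R) :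
  continuous (fun x : 'cV[R]_n => expR (- (c * sqn x))).
Proof.
apply: continuous_fun_comp; first exact: continuous_expR.
apply: (continuous_fun_comp (g := -%R)); first exact: opp_continuous.
apply: continuous_funM; first exact: cst_continuous.
rewrite (_ : sqn = qf 1%:M); first exact: continuous_qf.
by apply/funext => x; exact: sqn_qf.
Qed.

Lemma integrable_compact_support {R : realType} n (f : 'cV[R]_n -> R) K :
  continuous f -> compact K -> supported_in K f ->
  (lebesgue_cV n).-integrable [set: 'cV[R]_n] (EFin \o f).
Proof.
move=> cf cK fK.
have mf : measurable_fun [set: 'cV[R]_n] f by exact: continuous_measurable_cV.
have [C C0 fC] := compact_support_bound cf fK cK (continuous_expsqn (c := 1))
  (fun x => expR_gt0 _).
apply/integrableP; split; first exact/measurable_EFinP.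
apply: (@le_lt_trans _ _ (\int[lebesgue_cV n]_x (C%:E * (expR (- (1 * sqn x)))%:E))%E).
  apply: ge0_le_integral => //.
  - by apply: measurableT_comp => //; exact/measurable_EFinP.
  - by apply/measurable_EFinP/measurable_funM => //; exact: measurable_expsqn.
  - by move=> x _; rewrite /= lee_fin.
rewrite ge0_integralZl//.
- by rewrite lte_mul_pinfty// integral_expsqn_lty.
- by apply/measurable_EFinP; exact: measurable_expsqn.
Qed.

(** The derivative of [a * phi] has integral 0. The compact support of [phi] provides the Gaussian
    bounds of [integral_derive0], however fast [a] grows. *)
Lemma integral_by_parts {R : realType} n (i : 'I_n) (a da phi : 'cV[R]_n -> R) :
  continuous a -> continuous da -> (forall x, is_derive x (delta_mx i 0) a (da x)) ->
  test_function setT phi ->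
  (\int[lebesgue_cV n]_x (a x * pderiv i phi x)%:E =
   - \int[lebesgue_cV n]_x (da x * phi x)%:E)%E.
Proof.
move=> ca cda aE [phis [K [cK _ phiK]]].
have cphi : continuous phi by move=> x; exact: (phis [::] x Logic.I).2.
have cdphi : continuous (pderiv i phi) by move=> x; exact: (phis [:: i] x Logic.I).2.
have dphi x : is_derive x (delta_mx i 0) phi (pderiv i phi x).
  by apply: derivableP; exact: (phis [::] x Logic.I).1.
have closedK : closed K by apply: compact_closed => //; exact: norm_hausdorff.
have dphiK := supported_in_pderiv i closedK phiK.
pose f1 x := a x * pderiv i phi x; pose f2 x := da x * phi x.
have cf1 : continuous f1 by exact: continuous_funM.
have cf2 : continuous f2 by exact: continuous_funM.
have f1K : supported_in K f1 by move=> x Kx; rewrite /f1 dphiK// mulr0.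
have f2K : supported_in K f2 by move=> x Kx; rewrite /f2 phiK// mulr0.
have if1 := integrable_compact_support cf1 cK f1K.
have if2 := integrable_compact_support cf2 cK f2K.
pose psi x := a x * phi x; pose dpsi x := f1 x + f2 x.
have cpsi : continuous psi by exact: continuous_funM.
have psiK : supported_in K psi by move=> x Kx; rewrite /psi phiK// mulr0.
have cdpsi : continuous dpsi by exact: continuous_funD.
have dpsiK : supported_in K dpsi by move=> x Kx; rewrite /dpsi f1K// f2K// addr0.
have [C C0 psiC] := compact_support_bound cpsi psiK cK (continuous_expsqn (c := 2))
  (fun x => expR_gt0 _).
have [D D0 dpsiD] := compact_support_bound cdpsi dpsiK cK (continuous_expsqn (c := 2))
  (fun x => expR_gt0 _).
have dpsiE x : is_derive x (delta_mx i 0) psi (dpsi x).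
  have := is_deriveM (aE x) (dphi x).
  by rewrite /dpsi /f1 /f2 [da x * _]mulrC.
have int0 : (\int[lebesgue_cV n]_x (dpsi x)%:E = 0)%E.
  apply: (@integral_derive0 _ _ i psi dpsi (C + D)) => //.
  - exact: addr_ge0.
  - exact: continuous_measurable_cV.
  - by move=> x; apply: le_trans (psiC x) _; rewrite ler_wpM2r ?expR_ge0// lerDl.
  - by move=> x; apply: le_trans (dpsiD x) _; rewrite ler_wpM2r ?expR_ge0// lerDr.
move: int0; rewrite /dpsi; under eq_integral do rewrite EFinD.
rewrite integralD//.
rewrite -/(f1) -(fineK (integrable_fin_num measurableT if1)).
rewrite -(fineK (integrable_fin_num measurableT if2)) -EFinD -EFinN => -[] /eqP.
by rewrite addr_eq0 => /eqP ->.
Qed.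

(** * Hilbert-Schmidt operators *)

Section square_integrable.
Context d (T : measurableType d) (R : realType) (mu : {measure set T -> \bar R}).
Implicit Types f g : T -> R.
Local Open Scope ereal_scope.

Lemma Lfun2P f : f \in Lfun mu 2%:E <->
  measurable_fun [set: T] f /\ \int[mu]_x (f x ^+ 2)%:E < +oo.
Proof.
split=> [f2|[mf foo]].
  split; first by move: f2; rewrite inE => /andP[]; rewrite inE.
  have /integrableP[_] := Lfun2_integrable_sqr f2.
  by under eq_integral do rewrite /= ger0_norm ?sqr_ge0//.
rewrite inE; apply/andP; split; rewrite inE//= /finite_norm unlock poweR_lty//.
by under eq_integral do rewrite /= powR_mulrn// real_normK ?num_real//.
Qed.

Lemma Lnorm2_sqr f :
  (Lnorm mu 2%:E (EFin \o f)) `^ 2 = \int[mu]_x (f x ^+ 2)%:E.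
Proof.
rewrite powR_Lnorm//.
by apply: eq_integral => x _; rewrite /= powR_mulrn// real_normK ?num_real.
Qed.

Lemma le_Lnorm2_sqr (C : R) f g :
  Lnorm mu 2%:E (EFin \o f) <= C%:E * Lnorm mu 2%:E (EFin \o g) ->
  \int[mu]_x (f x ^+ 2)%:E <= (C ^+ 2)%:E * \int[mu]_x (g x ^+ 2)%:E.
Proof.
move=> h; rewrite -!Lnorm2_sqr.
(* The constant [C] may be negative; squaring is monotone only on nonnegative numbers. *)
have {h} : Lnorm mu 2%:E (EFin \o f) <= `|C|%:E * Lnorm mu 2%:E (EFin \o g).
  by apply: le_trans h _; rewrite lee_wpmul2r ?Lnorm_ge0// lee_fin ler_norm.
move=> /(gt0_ler_poweR (ler0n R 2)); rewrite !in_itv/= !leey !andbT.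
rewrite mule_ge0 ?lee_fin ?Lnorm_ge0// => /(_ isT isT); rewrite poweRM ?lee_fin ?Lnorm_ge0//.
by rewrite poweR_EFin powR_mulrn// real_normK ?num_real.
Qed.

Lemma Lfun2_mul_integrable f g : f \in Lfun mu 2%:E -> g \in Lfun mu 2%:E ->
  mu.-integrable [set: T] (fun x => (f x * g x)%:E).
Proof. by move=> f2 g2; apply/Lfun1_integrable; exact: Lfun2_mul_Lfun1. Qed.

Lemma cauchy_schwarz f g : f \in Lfun mu 2%:E -> g \in Lfun mu 2%:E ->
  ((\int[mu]_x (f x * g x)) ^+ 2 <=
   (\int[mu]_x (f x ^+ 2)) * (\int[mu]_x (g x ^+ 2)))%R.
Proof.
move=> f2 g2.
have ifg := Lfun2_mul_integrable f2 g2.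
have iff := Lfun2_integrable_sqr f2; have igg := Lfun2_integrable_sqr g2.
set a := (\int[mu]_x (f x ^+ 2))%R; set b := (\int[mu]_x (f x * g x))%R.
set c := (\int[mu]_x (g x ^+ 2))%R.
have q s t : (0 <= s ^+ 2 * a - 2 * s * t * b + t ^+ 2 * c)%R.
  have -> : (s ^+ 2 * a - 2 * s * t * b + t ^+ 2 * c =
      \int[mu]_x (s * f x - t * g x) ^+ 2)%R.
    under [RHS]eq_Rintegral => x _.
      rewrite (_ : (s * f x - t * g x) ^+ 2 =
        s ^+ 2 * (f x ^+ 2) + (- 2 * s * t) * (f x * g x) + t ^+ 2 * (g x ^+ 2))%R; last by ring.
      over.
    have i1 : mu.-integrable [set: T] (EFin \o (fun x => s ^+ 2 * (f x ^+ 2)))%R.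
      exact: (integrableZl measurableT (s ^+ 2)%R iff).
    have i2 : mu.-integrable [set: T] (EFin \o (fun x => (- 2 * s * t) * (f x * g x)))%R.
      exact: (integrableZl measurableT (- 2 * s * t)%R ifg).
    have i3 : mu.-integrable [set: T] (EFin \o (fun x => t ^+ 2 * (g x ^+ 2)))%R.
      exact: (integrableZl measurableT (t ^+ 2)%R igg).
    rewrite RintegralD//; last exact: (integrableD measurableT i1 i2).
    by rewrite RintegralD// !RintegralZl// -/a -/b -/c; ring.
  by apply: Rintegral_ge0 => x _; exact: sqr_ge0.
have a0 : (0 <= a)%R by apply: Rintegral_ge0 => x _; exact: sqr_ge0.
have c0 : (0 <= c)%R by apply: Rintegral_ge0 => x _; exact: sqr_ge0.
have [cz|cn0] := eqVneq c 0%R.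
  (* For [c = 0] the quadratic form at [(b, a + 1)] is [- (a + 2) * b ^+ 2], which forces
     [b = 0]. *)
  by have := q b (a + 1)%R; rewrite cz; have := sqr_ge0 b; nra.
have := q c b.
have cp : (0 < c)%R by rewrite lt_def cn0.
have -> : (c ^+ 2 * a - 2 * c * b * b + b ^+ 2 * c = c * (a * c - b ^+ 2))%R by ring.
by rewrite pmulr_rge0// subr_ge0.
Qed.

Lemma integral_sqrB_le f g : f \in Lfun mu 2%:E -> g \in Lfun mu 2%:E ->
  \int[mu]_x ((f - g) x ^+ 2)%:E <=
  2%:E * \int[mu]_x (f x ^+ 2)%:E + 2%:E * \int[mu]_x (g x ^+ 2)%:E.
Proof.
move=> /Lfun2P[mf _] /Lfun2P[mg _].
have msqr (h : T -> R) : measurable_fun [set: T] h ->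
    measurable_fun [set: T] (fun x => (h x ^+ 2)%:E).
  by move=> mh; apply/measurable_EFinP; exact: measurable_funX.
have sqr0 (h : T -> R) x : setT x -> 0 <= (h x ^+ 2)%:E by rewrite lee_fin sqr_ge0.
rewrite -!ge0_integralZl//; [|exact: msqr|exact: sqr0|exact: msqr|exact: sqr0].
rewrite -ge0_integralD//; last 4 first.
- by move=> x _; rewrite mule_ge0// sqr0.
- by apply: emeasurable_funM => //; exact: msqr.
- by move=> x _; rewrite mule_ge0// sqr0.
- by apply: emeasurable_funM => //; exact: msqr.
apply: ge0_le_integral => //.
- exact: sqr0.
- by apply: msqr; exact: measurable_funB.
- by apply: emeasurable_funD; apply: emeasurable_funM => //; exact: msqr.
- move=> x _; rewrite -!EFinM -EFinD lee_fin -[(f - g)%R x]/(f x - g x)%R.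
  by have := sqr_ge0 (f x + g x)%R; rewrite !expr2; nra.
Qed.

End square_integrable.

Section hilbert_schmidt.
Context d (T : measurableType d) (R : realType) (mu : probability T R).
Implicit Types (k : T * T -> R) (u v : T -> R).

(** On the null set of those [x] where the section of [k] is not square integrable, the integral may
    take its default value; identities such as [hs_linear] therefore hold almost everywhere. *)
Definition hsop k v x : R := \int[mu]_z (k (x, z) * v z).

Definition hskernel k := measurable_fun [set: T * T] k /\
  (\int[(mu \x mu)%E]_p (k p ^+ 2)%:E < +oo)%E.

Lemma hs_prod_integrable k v : hskernel k -> v \in Lfun mu 2%:E ->
  (mu \x mu)%E.-integrable [set: T * T] (fun p => (k p * v p.2)%:E).
Proof.
move=> [mk koo] /Lfun2P[mv voo].
have mv2 : measurable_fun [set: T * T] (fun p => v p.2).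
  exact: measurableT_comp mv measurable_snd.
have sq : (\int[(mu \x mu)%E]_p (v p.2 ^+ 2)%:E < +oo)%E.
  rewrite fubini_tonelli1//=; last 2 first.
  - by apply/measurable_EFinP; exact: measurable_funX.
  - by move=> p; rewrite lee_fin sqr_ge0.
  have /= -> := integral_cst mu measurableT (\int[mu]_y (v y ^+ 2)%:E)%E.
  by rewrite probability_setT mule1.
apply/(Lfun2_mul_integrable (f := k) (g := fun p => v p.2)); exact/Lfun2P.
Qed.

Lemma hs_measurable k v : hskernel k -> v \in Lfun mu 2%:E ->
  measurable_fun [set: T] (hsop k v).
Proof.
move=> hk v2; have := measurable_fubini_F (hs_prod_integrable hk v2).
by apply: measurableT_comp; exact: fine_measurable.
Qed.

Lemma hs_ae_kernel k : hskernel k ->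
  {ae mu, forall x, (fun z => k (x, z)) \in Lfun mu 2%:E}.
Proof.
move=> [mk koo].
have ik : (mu \x mu)%E.-integrable [set: T * T] (fun p => (k p ^+ 2)%:E).
  apply/integrableP; split; first by apply/measurable_EFinP; exact: measurable_funX.
  by under eq_integral do rewrite gee0_abs ?lee_fin ?sqr_ge0//.
have := ae_integrable1 ik; apply: filterS => x /integrableP[_ kx].
apply/Lfun2P; split; first exact: measurableT_comp mk (measurable_fun_pair _ _).
suff -> : (\int[mu]_z (k (x, z) ^+ 2)%:E = \int[mu]_z `|(k (x, z) ^+ 2)%:E|)%E by [].
by apply: eq_integral => z _; rewrite gee0_abs// lee_fin sqr_ge0.
Qed.

Lemma hs_bound k v : hskernel k -> v \in Lfun mu 2%:E ->
  (\int[mu]_x (hsop k v x ^+ 2)%:E <=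
   (\int[(mu \x mu)%E]_p (k p ^+ 2)%:E) * (\int[mu]_x (v x ^+ 2)%:E))%E.
Proof.
move=> hk v2; have [mk koo] := hk; have mkv := hs_measurable hk v2.
have mk2 : measurable_fun [set: T * T] (fun p => (k p ^+ 2)%:E).
  by apply/measurable_EFinP; exact: measurable_funX.
have k20 p : (0 <= (k p ^+ 2)%:E)%E by rewrite lee_fin sqr_ge0.
rewrite fubini_tonelli1//.
have v0 : (0 <= \int[mu]_x (v x ^+ 2)%:E)%E.
  by apply: integral_ge0 => x _; rewrite lee_fin sqr_ge0.
rewrite -ge0_integralZr//; last 2 first.
- exact: (measurable_fun_fubini_tonelli_F (fun p => (k p ^+ 2)%:E)).
- by move=> x _; apply: integral_ge0 => z _.
apply: ae_ge0_le_integral => //.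
- by move=> x _; rewrite lee_fin sqr_ge0.
- by apply/measurable_EFinP; exact: measurable_funX.
- by move=> x _; rewrite mule_ge0//; apply: integral_ge0 => z _.
- apply: emeasurable_funM => //.
  exact: (measurable_fun_fubini_tonelli_F (fun p => (k p ^+ 2)%:E)).
apply: filterS (hs_ae_kernel hk) => x kx _.
have fin f : f \in Lfun mu 2%:E -> (\int[mu]_z (f z ^+ 2)%:E = (\int[mu]_z (f z ^+ 2))%:E)%E.
  by move=> f2; rewrite fineK// integrable_fin_num//; exact: Lfun2_integrable_sqr.
have /= Ek := fin _ kx; have /= Ev := fin _ v2.
by rewrite /= /fubini_F Ek Ev -EFinM lee_fin; exact: cauchy_schwarz kx v2.
Qed.

Lemma hs_Lfun k v : hskernel k -> v \in Lfun mu 2%:E -> hsop k v \in Lfun mu 2%:E.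
Proof.
move=> hk v2; apply/Lfun2P; split; first exact: hs_measurable.
apply: le_lt_trans (hs_bound hk v2) _.
have /Lfun2P[_ voo] := v2; have [_ koo] := hk.
have k0 : (0 <= \int[(mu \x mu)%E]_p (k p ^+ 2)%:E)%E.
  by apply: integral_ge0 => p _; rewrite lee_fin sqr_ge0.
have v0 : (0 <= \int[mu]_x (v x ^+ 2)%:E)%E.
  by apply: integral_ge0 => x _; rewrite lee_fin sqr_ge0.
by rewrite lte_mul_pinfty// ge0_fin_numE.
Qed.

Lemma hs_linear k a u v : hskernel k -> u \in Lfun mu 2%:E -> v \in Lfun mu 2%:E ->
  {ae mu, forall x, hsop k (a *: u + v) x = a * hsop k u x + hsop k v x}.
Proof.
move=> hk u2 v2; apply: filterS (hs_ae_kernel hk) => x kx.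
have iu := Lfun2_mul_integrable kx u2; have iv := Lfun2_mul_integrable kx v2.
rewrite /hsop (_ : \int[mu]_z _ = \int[mu]_z (a * (k (x, z) * u z) + k (x, z) * v z)).
  rewrite RintegralD//; last exact: (integrableZl measurableT a iu).
  by rewrite RintegralZl.
by apply: eq_Rintegral => z _; rewrite -[(a *: u + v) z]/(a * u z + v z); ring.
Qed.

(** Fubini, justified by the boundedness of [theta]. With the integral in [z] outermost, an
    operation in [x] on [theta] meets only the kernel and not [v]. *)
Lemma hs_pairing k v (theta : T -> R) (C : R) : hskernel k -> v \in Lfun mu 2%:E ->
  measurable_fun [set: T] theta -> (forall x, `|theta x| <= C) ->
  \int[mu]_x (hsop k v x * theta x) =
  \int[mu]_z (v z * \int[mu]_x (k (x, z) * theta x)).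
Proof.
move=> hk v2 mth thC; have [mk _] := hk.
have imul w : w \in Lfun mu 2%:E ->
    (mu \x mu)%E.-integrable [set: T * T] (fun p => (k p * w p.2 * theta p.1)%:E).
  move=> w2; have ikw := hs_prod_integrable hk w2.
  apply: le_integrable (integrableZl measurableT `|C| ikw) => //.
    have /measurable_int/measurable_EFinP mkw := ikw.
    apply/measurable_EFinP/measurable_funM => //.
    exact: measurableT_comp mth measurable_fst.
  move=> p _; rewrite -EFinM !abse_EFin lee_fin !normrM normr_id [leLHS]mulrC ler_wpM2r ?mulr_ge0//.
  exact: le_trans (thC _) (ler_norm _).
have iv := imul _ v2.
have i1 : (mu \x mu)%E.-integrable [set: T * T] (fun p => (k p * theta p.1)%:E).
  have := imul _ (Lfun_cst mu 1 2).
  by apply: eq_integrable => // p _; rewrite /= mulr1.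
have := Fubini iv.
rewrite /Rintegral => E; congr fine.
transitivity (\int[mu]_x \int[mu]_z (k (x, z) * v z * theta x)%:E)%E.
  apply: ae_eq_integral => //.
  - apply/measurable_EFinP/measurable_funM => //; exact: hs_measurable.
  - exact: measurable_fubini_F iv.
  apply: filterS (ae_integrable1 (hs_prod_integrable hk v2)) => x ix _.
  under [RHS]eq_integral do rewrite EFinM.
  by rewrite integralZr// EFinM /hsop fineK// integrable_fin_num.
rewrite E; apply: ae_eq_integral => //.
- exact: measurable_fubini_G iv.
- have /Lfun2P[mv _] := v2.
  apply/measurable_EFinP/measurable_funM => //.
  by have := measurable_fubini_G i1; apply: measurableT_comp; exact: fine_measurable.
apply: filterS (ae_integrable2 i1) => z iz _ /=.
rewrite /Rintegral EFinM fineK ?integrable_fin_num// -integralZl//.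
by apply: eq_integral => x _ /=; rewrite -EFinM; congr EFin; ring.
Qed.

End hilbert_schmidt.

(** * Operators vanishing on bounded continuous functions *)

Lemma Lfun2_bounded d (T : measurableType d) (R : realType) (mu : probability T R)
    (f : T -> R) (c : R) : measurable_fun [set: T] f -> (forall x, `|f x| <= c) ->
  f \in Lfun mu 2%:E.
Proof.
move=> mf fc; apply/Lfun2P; split=> //.
apply: (@le_lt_trans _ _ (\int[mu]_x (cst (c ^+ 2)%:E x))%E).
  apply: ge0_le_integral => //.
  - by move=> x _; rewrite lee_fin sqr_ge0.
  - by apply/measurable_EFinP; exact: measurable_funX.
  - move=> x _; rewrite lee_fin -[leLHS]real_normK ?num_real//.
    by rewrite lerXn2r// nnegrE// (le_trans _ (fc x)).
by rewrite integral_cst//= probability_setT mule1 ltry.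
Qed.

Lemma Lfun2_lin d (T : measurableType d) (R : realType) (mu : {measure set T -> \bar R})
    (a : R) (u v : T -> R) :
  u \in Lfun mu 2%:E -> v \in Lfun mu 2%:E -> a *: u + v \in Lfun mu 2%:E.
Proof.
move=> u2 v2; have := Lfun_submod_closed mu (lee1n 2).
by move=> [_ /(_ a u v u2 v2)].
Qed.

Section null_operator.
Context d (T : measurableType d) (R : realType) (mu : probability T R).
Variable D : (T -> R) -> (T -> R).
Local Notation L2 := (Lfun mu 2%:E).
Hypothesis D_L2 : forall u, u \in L2 -> D u \in L2.
Hypothesis D_lin : forall a u v, u \in L2 -> v \in L2 ->
  {ae mu, forall x, D (a *: u + v) x = a * D u x + D v x}.
Variable C : R.
Hypothesis D_bd : forall u, u \in L2 ->
  (\int[mu]_x (D u x ^+ 2)%:E <= C%:E * \int[mu]_x (u x ^+ 2)%:E)%E.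

(** [D] stands for the difference of the semigroup and the Mehler operator. Both act on
    representatives, so that linearity and vanishing make sense only almost everywhere. *)
Definition null_at u := u \in L2 /\ {ae mu, forall x, D u x = 0}.

Lemma null_lin a u v : null_at u -> null_at v -> null_at (a *: u + v).
Proof.
move=> [u2 u0] [v2 v0]; split; first exact: Lfun2_lin.
by apply: filterS3 (D_lin a u2 v2) u0 v0 => x -> -> ->; rewrite mulr0 addr0.
Qed.

(** Almost everywhere [D v = D (v - v_ k)], and the square integral of the latter is at most [C]
    times that of [v - v_ k], which tends to 0 by dominated convergence. *)
Lemma null_cvg (v_ : (T -> R)^nat) v g : (forall k, null_at (v_ k)) -> v \in L2 -> g \in L2 ->
  (forall x, v_ k x @[k --> \oo] --> v x) -> (forall k x, `|v x - v_ k x| <= g x) ->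
  null_at v.
Proof.
move=> v_0 v2 g2 vcvg vg; split=> //.
have [mDv _] := (Lfun2P _ _).1 (D_L2 v2).
have mDv2 : measurable_fun [set: T] (fun x => (D v x ^+ 2)%:E).
  by apply/measurable_EFinP; exact: measurable_funX.
have le k : (\int[mu]_x (D v x ^+ 2)%:E <= C%:E * \int[mu]_x ((v x - v_ k x) ^+ 2)%:E)%E.
  have [vk2 vk0] := v_0 k.
  have dv2 : v - v_ k \in L2.
    rewrite (_ : v - v_ k = (-1) *: v_ k + v); first exact: Lfun2_lin.
    by rewrite scaleN1r addrC.
  have := D_bd dv2; apply: le_trans.
  apply: ae_ge0_le_integral => //.
  - by move=> x _; rewrite lee_fin sqr_ge0.
  - by move=> x _; rewrite lee_fin sqr_ge0.
  - by have /Lfun2P[m _] := D_L2 dv2; apply/measurable_EFinP; exact: measurable_funX.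
  have := D_lin 1 dv2 vk2.
  rewrite scale1r subrK => DE.
  by apply: filterS2 DE vk0 => x -> -> _; rewrite mul1r addr0.
have lim : (C%:E * \int[mu]_x ((v x - v_ k x) ^+ 2)%:E)%E @[k --> \oo] -->
    (C%:E * \int[mu]_x (cst 0 x)%:E)%E.
  apply: cvgeZl => //.
  have [mv _] := (Lfun2P _ _).1 v2.
  have mv_ k : measurable_fun [set: T] (v_ k).
    by have [/Lfun2P[m _] _] := v_0 k.
  apply: (dominated_cvg_EFin (g := fun x => g x ^+ 2)).
  - by move=> k; apply: measurable_funX; exact: measurable_funB.
  - move=> x /=; rewrite (_ : 0 = (v x - v x) ^+ 2); last by rewrite subrr expr0n.
    apply: (continuous_cvg _ (@exprn_continuous R 2 _)).
    by apply: cvgB; [exact: cvg_cst|exact: vcvg].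
  - exact: Lfun2_integrable_sqr.
  - move=> k x; rewrite ger0_norm ?sqr_ge0// -[leLHS]real_normK ?num_real//.
    by rewrite lerXn2r// nnegrE// (le_trans _ (vg k x)).
rewrite integral0 mule0 in lim.
have int0 : (\int[mu]_x `|(D v x ^+ 2)%:E| = 0)%E.
  apply/eqP; rewrite eq_le integral_ge0 ?andbT//.
  under eq_integral do rewrite gee0_abs ?lee_fin ?sqr_ge0//.
  by apply: cvge_ge lim; apply: nearW.
have := (ae_eq_integral_abs mu measurableT mDv2).1 int0.
by apply: filterS => x /= /(_ Logic.I) [] /eqP; rewrite sqrf_eq0 => /eqP.
Qed.

Lemma null_sum (I : Type) (r : seq I) (F : I -> T -> R) : null_at (cst 0) ->
  (forall i, null_at (F i)) -> null_at (fun x => \sum_(i <- r) F i x).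
Proof.
move=> n0 nF; elim: r => [|i r IH].
  by rewrite (_ : (fun x => _) = cst 0)//; apply/funext => x; rewrite big_nil.
rewrite (_ : (fun x => _) = 1 *: F i + (fun x => \sum_(i <- r) F i x)).
  exact: null_lin.
by rewrite scale1r; apply/funext => x; rewrite big_cons.
Qed.

(** A Dynkin class argument: complements follow from linearity and the constant 1, disjoint unions
    from [null_cvg] with all partial sums dominated by 1. *)
Lemma null_indic (G : set (set T)) :
  @measurable _ T = <<s G >> -> setI_closed G -> null_at (cst 1) ->
  (forall A, G A -> null_at (\1_A)) -> forall A, measurable A -> null_at (\1_A).
Proof.
move=> GE GI n1 nG A mA.
have n0 : null_at (cst 0).
  rewrite (_ : cst 0 = (-1) *: (cst 1) + cst 1); first exact: null_lin.
  by rewrite scaleN1r addNr.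
rewrite GE in mA; move: A mA; apply: dynkin_induction => //.
- by rewrite indicT.
- move=> S mS nS; rewrite (_ : \1_(~` S) = (-1) *: \1_S + cst 1); first exact: null_lin.
  apply/funext => x; rewrite indicE in_setC scaleN1r /=.
  rewrite -[RHS]/(- \1_S x + 1) indicE.
  by case: (x \in S) => /=; rewrite ?oppr0 ?add0r// addNr.
- move=> F mF tF nF.
  have sumE k x : \sum_(i < k) \1_(F i) x = \1_(\bigcup_(i < k) F i) x :> R.
    rewrite [RHS]indicE; case: (boolP (x \in _)).
      rewrite inE => -[i /= ik Fi]; rewrite (bigD1 (Ordinal ik))//= indicE mem_set//.
      rewrite big1 ?addr0// => j ji; rewrite indicE memNset//= => Fj.
      move: ji; rewrite -val_eqE/= => /eqP; apply.
      by apply: (tF j i) => //; exists x.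
    rewrite notin_setE => nF'; rewrite big1// => i _.
    by rewrite indicE memNset// => Fi; apply: nF'; exists i => /=.
  apply: (@null_cvg (fun k x => \sum_(i < k) \1_(F i) x) _ (cst 1)).
  + by move=> k; exact: null_sum.
  + apply: (@Lfun2_bounded _ _ _ _ _ 1).
      by apply: measurable_indic; exact: bigcup_measurable.
    by move=> x; rewrite indicE; case: (_ \in _); rewrite /= ?normr1 ?normr0.
  + by apply: (@Lfun2_bounded _ _ _ _ _ 1) => // x; rewrite /= normr1.
  + move=> x; under eq_cvg do rewrite sumE.
    rewrite [\1_(\bigcup_k F k) x]indicE; case: (boolP (x \in _)).
      rewrite inE => -[i _ Fi]; apply: cvg_near_cst.
      near=> k; rewrite indicE mem_set//; exists i => //=.
      by near: k; exists i.+1.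
    rewrite notin_setE => nF'; apply: cvg_near_cst; apply: nearW => k.
    by rewrite indicE memNset// => -[i _ Fi]; apply: nF'; exists i.
  + move=> k x; rewrite sumE !indicE.
    by do 2 case: (_ \in _); rewrite /= ?subrr ?subr0 ?sub0r ?normrN ?normr1 ?normr0.
Unshelve. all: by end_near. Qed.

Import HBNNSimple.

Lemma null_all : (forall A, measurable A -> null_at (\1_A)) ->
  forall v, v \in L2 -> null_at v.
Proof.
move=> nA.
have n0 : null_at (cst 0) by rewrite -indic0; exact: nA.
have nZ a u : null_at u -> null_at (a *: u).
  by move=> nu; rewrite -[a *: u]addr0; exact: (null_lin a nu n0).
have nsf (f : {nnsfun T >-> R}) : null_at f.
  rewrite (_ : (f : T -> R) = fun x => \sum_(y <- finmap.enum_fset (fset_set (range f)))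
      (y *: (\1_(f @^-1` [set y]) : T -> R)) x); last first.
    apply/funext => x; rewrite fimfunE fsbig_finite//=.
  by apply: null_sum => // y; apply: nZ; exact: nA.
have nge0 v : v \in L2 -> (forall x, 0 <= v x) -> null_at v.
  move=> v2 v0; have [mv _] := (Lfun2P _ _).1 v2.
  have mv' : measurable_fun [set: T] (EFin \o v) by exact/measurable_EFinP.
  have v0' x : setT x -> (0 <= (EFin \o v) x)%E by move=> _; rewrite lee_fin.
  pose v_ := nnsfun_approx measurableT mv'.
  have vcvg x : v_ k x @[k --> \oo] --> v x.
    have := cvg_nnsfun_approx measurableT mv' v0' (Logic.I : setT x).
    by move=> /fine_cvg; apply: cvg_trans; apply: near_eq_cvg; exact: nearW.
  have le k x : v_ k x <= v x.
    rewrite -(cvg_lim _ (vcvg x))//.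
    apply: (@nondecreasing_cvgn_le _ (v_ ^~ x)); last exact: cvgP (vcvg x).
    by move=> a b ab; exact/lefP/nd_nnsfun_approx.
  apply: (@null_cvg (fun k => v_ k) _ v) => //.
  - by move=> k x; rewrite ger0_norm ?subr_ge0// lerBlDr lerDl fun_ge0.
move=> v v2; have [mv _] := (Lfun2P _ _).1 v2.
have nmax (f : T -> R) : measurable_fun [set: T] f -> (forall x, `|f x| = `|v x|) ->
    null_at (fun x => Num.max (f x) 0).
  move=> mf fv; have [_ voo] := (Lfun2P _ _).1 v2.
  have mm : measurable_fun [set: T] (fun x => Num.max (f x) 0) by exact: measurable_maxr.
  apply: nge0 => [|x]; last by rewrite le_max lexx orbT.
  apply/Lfun2P; split=> //; apply: le_lt_trans voo; apply: ge0_le_integral => //.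
  - by move=> x _; rewrite lee_fin sqr_ge0.
  - by apply/measurable_EFinP; exact: measurable_funX.
  - by apply/measurable_EFinP; exact: measurable_funX.
  - move=> x _; rewrite lee_fin -[leRHS]real_normK ?num_real// -fv.
    rewrite lerXn2r// ?nnegrE//; first by rewrite le_max lexx orbT.
    by rewrite ge_max normr_ge0 ler_norm.
have npos := nmax v mv (fun=> erefl).
have nneg : null_at (fun x => Num.max (- v x) 0).
  by apply: nmax => [|x]; [exact: measurableT_comp|exact: normrN].
rewrite (_ : v = (-1) *: (fun x => Num.max (- v x) 0) + (fun x => Num.max (v x) 0)).
  exact: null_lin.
apply/funext => x; rewrite scaleN1r -[RHS]/(- Num.max (- v x) 0 + Num.max (v x) 0).
by rewrite /Num.max; case: ltP => h1; case: ltP => h2; lra.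
Qed.

End null_operator.

Section orthants.
Context {R : realType} {n : nat}.
Local Notation E := 'cV[R]_n.
Implicit Types a x : E.

(** Closed orthants are stable under intersection and generate the sigma-algebra, and their
    indicators are pointwise limits of continuous functions with values in [[0, 1]]. *)
Definition orthant a : set E := [set x | forall i, x i 0 <= a i 0].

Lemma measurable_orthant a : measurable (orthant a).
Proof.
have -> : orthant a = \big[setI/setT]_(i < n)
    ((fun x : E => x i 0) @^-1` `]-oo, a i 0]%classic).
  rewrite -bigcap_seq/=; apply/seteqP; split => x /=.
    by move=> h i _; rewrite /= in_itv/=; exact: h.
  by move=> h i; have /= := h i (mem_index_enum i); rewrite in_itv/=.
apply: bigsetI_measurable => i _; rewrite -[X in measurable X]setTI.
by apply: measurable_cV_coord => //; exact: measurable_itv.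
Qed.

Lemma orthantI : setI_closed (range orthant).
Proof.
move=> _ _ [a _ <-] [b _ <-]; exists (\col_i Num.min (a i 0) (b i 0)) => //.
apply/seteqP; split => x /=.
  by move=> h; split=> i; have := h i; rewrite mxE le_min => /andP[].
by move=> [ha hb] i; rewrite mxE le_min ha hb.
Qed.

Lemma measurable_orthantE : @measurable _ E = <<s range orthant >>.
Proof.
apply/seteqP; split; last first.
  by apply: smallest_sub; [exact: sigma_algebra_measurable|move=> _ [a _ <-]; exact: measurable_orthant].
pose U := g_sigma_algebraType (range orthant).
have mcoord i : measurable_fun [set: U] (fun x : U => (x : E) i 0).
  apply: (measurability (@RGenOInfty.G R)); first exact: RGenOInfty.measurableE.
  move=> _ [_ [c ->] <-]; rewrite setTI.
  (* The half-space [x i 0 <= c] is the union over [k] of the orthants with bound [c] in coordinate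
     [i] and [k] in all others. *)
  rewrite (_ : _ @^-1` _ = ~` \bigcup_k (orthant (\col_j if j == i then c else k%:R) : set U)).
    apply: measurableC; apply: bigcup_measurable => k _.
    by apply: sub_sigma_algebra; eexists.
  apply/seteqP; split => x /=; rewrite in_itv/= andbT.
    by move=> cx [k _ /(_ i)]; rewrite mxE eqxx leNgt cx.
  move=> h; rewrite ltNge; apply/negP => xc; apply: h.
  exists (Num.truncn (\sum_j `|(x : E) j 0|)).+1 => // j; rewrite mxE.
  case: eqP => [->//|_]; apply: le_trans (ler_norm _) _.
  apply: (@le_trans _ _ (\sum_j `|(x : E) j 0|)); last exact/ltW/truncnS_gt.
  by rewrite (bigD1 j)//= lerDl sumr_ge0.
have mid : measurable_fun [set: U] (fun x : U => x : E) by exact: measurable_fun_cVP.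
by move=> A mA; have := mid measurableT A mA; rewrite setTI.
Qed.

(** Each factor is 1 where [x i 0 <= a i 0] and tends to 0 with growing [k] elsewhere, so a single
    violated inequality makes the product tend to 0. *)
Definition orthant_approx k a x : R :=
  \prod_i (1 + k%:R * Num.max (x i 0 - a i 0) 0)^-1.

Let fac_gt0 (k : nat) (t : R) : 0 < 1 + k%:R * Num.max t 0.
Proof. by rewrite ltr_wpDr// mulr_ge0// le_max lexx orbT. Qed.

Let fac_le1 (k : nat) (t : R) : (1 + k%:R * Num.max t 0)^-1 <= 1.
Proof. by rewrite invf_le1// lerDl mulr_ge0// le_max lexx orbT. Qed.

Lemma orthant_approx_ge0 k a x : 0 <= orthant_approx k a x.
Proof. by apply: prodr_ge0 => i _; rewrite invr_ge0 ltW. Qed.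

Lemma orthant_approx_le1 k a x : orthant_approx k a x <= 1.
Proof. by apply: prodr_ile1 => i _; rewrite fac_le1 andbT invr_ge0 ltW. Qed.

Lemma orthant_approx_continuous k a : continuous (orthant_approx k a).
Proof.
rewrite (_ : orthant_approx k a = fun x =>
  \prod_i (1 + k%:R * Num.max (x i 0 - a i 0) 0)^-1)//.
apply: continuous_fun_prod => i.
apply: continuous_funV => [x|]; first by rewrite gt_eqF.
apply: continuous_funD; first exact: cst_continuous.
apply: continuous_funM; first exact: cst_continuous.
apply: (continuous_fun_comp (g := fun t => Num.max (t - a i 0) 0)); last exact: coord_continuous.
rewrite (_ : (fun t => _) = fun t : R => 2^-1 * ((t - a i 0) + `|t - a i 0|)); last first.
  by apply/funext => t; rewrite /Num.max; case: ltP => h; [rewrite ltr0_norm|rewrite ger0_norm]; lra.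
apply: continuous_funM; first exact: cst_continuous.
have cs : continuous (fun t : R => t - a i 0).
  by move=> t; apply: cvgB; [exact: cvg_id|exact: cvg_cst].
apply: continuous_funD => //; apply: (continuous_fun_comp (g := Num.norm)) => //.
exact: norm_continuous.
Qed.

Lemma orthant_approx_cvg a x : orthant_approx k a x @[k --> \oo] --> (\1_(orthant a) x : R).
Proof.
rewrite indicE; case: (boolP (x \in _)).
  rewrite inE => h; apply: cvg_near_cst; apply: nearW => k.
  rewrite /orthant_approx big1// => i _.
  by rewrite max_r ?mulr0 ?addr0 ?invr1// subr_le0; exact: h.
rewrite notin_setE => /existsNP[i /negP]; rewrite -ltNge => ai.
have xa : x i 0 - a i 0 != 0 by rewrite gt_eqF// subr_gt0.
have xa0 : 0 <= x i 0 - a i 0 by rewrite subr_ge0 ltW.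
have c0 : (fun=> 0) k @[k --> \oo] --> (0 : R) by exact: cvg_cst.
rewrite mulr0n.
apply: (@squeeze_cvgr _ _ _ _ (fun=> 0) (fun k : nat => (1 + k%:R * (x i 0 - a i 0))^-1)
  (fun k => orthant_approx k a x) _ 0 c0).
  apply: nearW => k; rewrite orthant_approx_ge0/= /orthant_approx (bigD1 i)//=.
  rewrite (max_l xa0) ler_piMr//.
    by rewrite invr_ge0 addr_ge0// mulr_ge0.
  by apply: prodr_ile1 => j _; rewrite fac_le1 andbT invr_ge0 ltW.
have s0 : 0 < x i 0 - a i 0 by rewrite subr_gt0.
apply/cvgrPdist_lt => e e0; near=> k.
rewrite sub0r normrN ger0_norm; last by rewrite invr_ge0 addr_ge0// mulr_ge0// ltW.
rewrite -[ltRHS]invrK ltf_pV2 ?posrE ?invr_gt0//; last first.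
  by rewrite ltr_wpDr// mulr_ge0// ltW.
have : e^-1 / (x i 0 - a i 0) < k%:R by near: k; exact: nbhs_infty_gtr.
by rewrite ltr_pdivrMr// => h; apply: lt_trans h _; rewrite ltrDr.
Unshelve. all: by end_near. Qed.

End orthants.

Lemma null_bounded_continuous {R : realType} n (mu : probability 'cV[R]_n R)
    (D : ('cV[R]_n -> R) -> ('cV[R]_n -> R)) (C : R) :
  (forall u, u \in Lfun mu 2%:E -> D u \in Lfun mu 2%:E) ->
  (forall a u v, u \in Lfun mu 2%:E -> v \in Lfun mu 2%:E ->
    {ae mu, forall x, D (a *: u + v) x = a * D u x + D v x}) ->
  (forall u, u \in Lfun mu 2%:E ->
    (\int[mu]_x (D u x ^+ 2)%:E <= C%:E * \int[mu]_x (u x ^+ 2)%:E)%E) ->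
  (forall f, bounded_continuous f -> {ae mu, forall x, D f x = 0}) ->
  forall v, v \in Lfun mu 2%:E -> {ae mu, forall x, D v x = 0}.
Proof.
move=> D2 Dl Db D0 v v2.
have L2b (f : 'cV[R]_n -> R) : measurable_fun [set: 'cV[R]_n] f ->
    (forall x, `|f x| <= 1) -> f \in Lfun mu 2%:E.
  exact: Lfun2_bounded.
have capp k a : (orthant_approx k a : 'cV[R]_n -> R) \in Lfun mu 2%:E.
  apply: L2b; first by apply: continuous_measurable_cV; exact: orthant_approx_continuous.
  by move=> x; rewrite ger0_norm ?orthant_approx_ge0// orthant_approx_le1.
have c1 : (cst 1 : 'cV[R]_n -> R) \in Lfun mu 2%:E by apply: L2b => // x; rewrite /= normr1.
suff nA : forall A, measurable A -> null_at mu D (\1_A : 'cV[R]_n -> R).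
  by have [] := null_all D2 Dl Db nA v2.
apply: (null_indic D2 Dl Db measurable_orthantE orthantI).
  split=> //; apply: D0; split; first exact: cst_continuous.
  by exists 1 => x; rewrite /= normr1.
move=> _ [a _ <-].
apply: (null_cvg D2 Dl Db (v_ := fun k => orthant_approx k a) (g := cst 1)) => //.
- move=> k; split=> //; apply: D0; split; first exact: orthant_approx_continuous.
  by exists 1 => x; rewrite ger0_norm ?orthant_approx_ge0// orthant_approx_le1.
- apply: L2b; first by apply: measurable_indic; exact: measurable_orthant.
  by move=> x; rewrite indicE; case: (_ \in _); rewrite /= ?normr1 ?normr0.
- exact: orthant_approx_cvg.
- move=> k x /=; rewrite indicE ler_norml.
  have := orthant_approx_ge0 k a x; have := orthant_approx_le1 k a x.
  by case: (_ \in _) => /= *; apply/andP; split; lra.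
Qed.

(** * Weak derivatives of Mehler integrals *)

Section test_functions.
Context {R : realType} {n : nat}.
Local Notation E := 'cV[R]_n.
Implicit Types (f g phi : E -> R).

(* Members have partial derivatives that are again members, hence are smooth. *)
Inductive smooth_closure : (E -> R) -> Prop :=
| smooth_closure_smooth f : smooth_on setT f -> smooth_closure f
| smooth_closure_cst c : smooth_closure (fun _ => c)
| smooth_closure_coord i : smooth_closure (fun x => x i 0)
| smooth_closureD f g : smooth_closure f -> smooth_closure g ->
    smooth_closure (fun x => f x + g x)
| smooth_closureM f g : smooth_closure f -> smooth_closure g ->
    smooth_closure (fun x => f x * g x).

Lemma smooth_on_pderiv f i : smooth_on setT f -> smooth_on setT (pderiv i f).
Proof.
move=> sf s x _; have := sf (rcons s i) x Logic.I.
by rewrite /pderivs foldr_rcons.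
Qed.

Lemma smooth_closure_derive f i : smooth_closure f ->
  exists2 g, smooth_closure g & forall x, is_derive x (delta_mx i 0) f (g x).
Proof.
elim=> {f} [f sf|c|j|f g cf [f' cf' df] cg [g' cg' dg]|f g cf [f' cf' df] cg [g' cg' dg]].
- exists (pderiv i f); first exact/smooth_closure_smooth/smooth_on_pderiv.
  by move=> x; apply: derivableP; exact: (sf [::] x Logic.I).1.
- by exists (fun=> 0) => [|x]; [exact: smooth_closure_cst|exact: is_derive_cst].
- exists (fun=> (delta_mx i 0 : E) j 0); first exact: smooth_closure_cst.
  by move=> x; exact: is_derive_coord.
- exists (fun x => f' x + g' x); first exact: smooth_closureD.
  by move=> x; exact: is_deriveD.
- exists (fun x => f x * g' x + g x * f' x).
    by apply: smooth_closureD; exact: smooth_closureM.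
  by move=> x; exact: is_deriveM.
Qed.

Lemma smooth_closure_continuous f : smooth_closure f -> continuous f.
Proof.
elim=> {f} [f sf x|c|j|f g _ cf _ cg|f g _ cf _ cg].
- exact: (sf [::] x Logic.I).2.
- exact: cst_continuous.
- exact: coord_continuous.
- exact: continuous_funD.
- exact: continuous_funM.
Qed.

Lemma smooth_closure_smooth_on f : smooth_closure f -> smooth_on setT f.
Proof.
move=> cf s; have : smooth_closure (pderivs s f).
  elim: s => //= i s /(smooth_closure_derive i)[g cg dg].
  rewrite (_ : pderiv i _ = g)//; apply/funext => x.
  by rewrite /pderiv; have [_ ->] := dg x.
move=> cs x _; split=> [i|]; last exact: smooth_closure_continuous.
by have [g _ /(_ x)[]] := smooth_closure_derive i cs.
Qed.

Lemma test_function_pderiv phi i : test_function setT phi ->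
  test_function setT (pderiv i phi).
Proof.
move=> [sphi [K [cK KT phiK]]]; split; first exact: smooth_on_pderiv.
exists K; split=> //; apply: supported_in_pderiv => //.
by apply: compact_closed => //; exact: norm_hausdorff.
Qed.

Lemma test_function_monomial phi alpha : test_function setT phi ->
  test_function setT (fun x => monomial alpha x * phi x).
Proof.
move=> [sphi [K [cK KT phiK]]]; split; last first.
  by exists K; split=> // x Kx; rewrite phiK// mulr0.
apply/smooth_closure_smooth_on/smooth_closureM; last exact: smooth_closure_smooth.
have cX i k : smooth_closure (fun x => x i 0 ^+ k).
  elim: k => [|k IH]; first exact: smooth_closure_cst.
  by under eq_fun do rewrite exprS; apply: smooth_closureM => //; exact: smooth_closure_coord.
rewrite /monomial; elim: (index_enum _) => [|i r IH].
  by under eq_fun do rewrite big_nil; exact: smooth_closure_cst.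
by under eq_fun do rewrite big_cons; exact: smooth_closureM.
Qed.

End test_functions.

(** Positive and negative parts are compared separately, so the two sides agree also when [f] is not
    integrable. *)
Lemma integral_density_div d (T : measurableType d) (R : realType)
    (nu mu : {measure set T -> \bar R}) (rho f : T -> R) :
  measurable_fun [set: T] rho -> (forall x, 0 < rho x) ->
  (forall A, measurable A -> mu A = (\int[nu]_(x in A) (rho x)%:E)%E) ->
  measurable_fun [set: T] (fun x => f x / rho x) ->
  (\int[mu]_x (f x / rho x)%:E = \int[nu]_x (f x)%:E)%E.
Proof.
move=> mrho rho0 muE mf; rewrite integralE [RHS]integralE.
have mF : measurable_fun [set: T] (fun x => (f x / rho x)%:E) by exact/measurable_EFinP.
have maxM a b : 0 < b -> Num.max (a / b) 0 * b = Num.max a 0 :> R.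
  by move=> b0; rewrite maxr_pMl ?(ltW b0)// divfK ?gt_eqF// mul0r.
congr (_ - _)%E.
  rewrite (ge0_integral_density mrho (fun x => ltW (rho0 x)) muE)//; last first.
    exact: measurable_funepos.
  apply: eq_integral => x _; rewrite !funeposE -!EFin_max -EFinM; congr EFin.
  exact: maxM.
rewrite (ge0_integral_density mrho (fun x => ltW (rho0 x)) muE)//; last first.
  exact: measurable_funeneg.
apply: eq_integral => x _; rewrite !funenegE -!EFinN -!EFin_max -EFinM; congr EFin.
by rewrite -mulNr; exact: maxM.
Qed.

(* No integrability is needed: an undefined difference [+oo - +oo] has [fine] value [0]. *)
Lemma RintegralN d (T : measurableType d) (R : realType) (mu : {measure set T -> \bar R})
    (f : T -> R) : \int[mu]_x (- f x) = - \int[mu]_x f x.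
Proof.
rewrite /Rintegral integralE [in RHS]integralE.
have -> : (fun x => (- f x)%:E)^\+%E = (fun x => (f x)%:E)^\-%E.
  by rewrite -funeposN; congr funepos.
have -> : (fun x => (- f x)%:E)^\-%E = (fun x => (f x)%:E)^\+%E.
  by rewrite -funenegN; congr funeneg.
have := integral_ge0 mu (fun x (_ : setT x) => funepos_ge0 (fun x => (f x)%:E) x).
have := integral_ge0 mu (fun x (_ : setT x) => funeneg_ge0 (fun x => (f x)%:E) x).
case: (integral _ _ _) => [a| |]; case: (integral _ _ _) => [b| |] //= _ _;
  by rewrite ?oppr0 ?opprB.
Qed.

Section mehler_kernel.
Context {R : realType} {n : nat}.
Local Notation E := 'cV[R]_n.
Variables (M N A : 'M[R]_n) (r : R) (mu : probability E R).
Hypotheses (r0 : 0 < r) (pM : posdef M) (pN : posdef N).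
Hypothesis muE : has_density mu (fun x => r * gexp N x).
Hypothesis J0 : forall x z, 0 <= jform M N A x z.

Let rho (x : E) := r * gexp N x.

Lemma rho_gt0 x : 0 < rho x.
Proof. by rewrite mulr_gt0// gexp_gt0. Qed.

Lemma measurable_rho : measurable_fun [set: E] rho.
Proof. by apply: measurable_funM => //; exact: measurable_gexp. Qed.

Lemma measurable_rhoV : measurable_fun [set: E] (fun x => (rho x)^-1).
Proof.
apply: continuous_measurable_cV; apply: continuous_funV => [x|].
  by rewrite gt_eqF// rho_gt0.
by apply: continuous_funM; [exact: cst_continuous|exact: continuous_gexp].
Qed.

(* Kernel with respect to [mu] of the operator of Lebesgue kernel
   [m x z * gexp M (A x - z)]; the semigroup is the case of a constant [m]. *)
Definition mehler (m : E -> E -> R) (q : E * E) : R :=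
  m q.1 q.2 * gexp M (A *m q.1 - q.2) / rho q.2.

Lemma measurable_mehler m : polyk m -> measurable_fun [set: E * E] (mehler m).
Proof.
move=> pm; apply: measurable_funM; last exact: measurableT_comp measurable_rhoV measurable_snd.
apply: measurable_funM; first exact: polyk_measurable.
apply: measurable_gexp; apply: measurable_fun_cVB => //.
exact: measurable_fun_mulmx.
Qed.

Lemma mehler_derive i m : polyk m -> exists2 m', polyk m' & forall x z,
  is_derive x (delta_mx i 0) (fun x => mehler m (x, z)) (mehler m' (x, z)).
Proof.
move=> pm; have [m' pm' dm] := polyk_derive i pm.
have [p' pp' dp] := polyk_derive i (polykM (polyk_cst (- 2^-1)) (polyk_qf M A)).
exists (fun x z => m' x z + m x z * p' x z); first by apply: polykD => //; exact: polykM.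
move=> x z.
have dG := is_derive_expR_comp (dp x z).
have H := is_deriveM (is_deriveM (dm x z) dG) (is_derive_cst (rho z)^-1 x (delta_mx i 0)).
apply: (@is_derive_eq _ _ _ (fun x => mehler m (x, z)) _ _ _ _ H).
rewrite /mehler /gexp /= scaler0 add0r /GRing.scale /=.
by rewrite [RHS]mulrC; congr (_ * _); ring.
Qed.

Lemma continuous_mehler m z : polyk m -> continuous (fun x => mehler m (x, z)).
Proof.
move=> pm; rewrite /mehler /=; apply: continuous_funM; last exact: cst_continuous.
apply: continuous_funM; first exact: polyk_continuous.
apply: (continuous_fun_comp (g := expR)
  (f := fun x => - 2^-1 * qf M (A *m x - z))); first exact: continuous_expR.
by have H := polyk_continuous (polykM (polyk_cst (- 2^-1)) (polyk_qf M A)); exact: H.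
Qed.

Let muE' A' : measurable A' -> mu A' = (\int[lebesgue_cV n]_(x in A') (rho x)%:E)%E.
Proof. exact: muE. Qed.

Lemma hskernel_mehler m : polyk m -> hskernel mu (mehler m).
Proof.
move=> pm; split; first exact: measurable_mehler.
have [e e0 he] := posdef_joint_form pM pN J0.
(* With [m] growing at rate [e / 4], its square costs [e / 2] of the decay [e] of the Gaussian
   factor; the remaining [e / 2] is the rate in [b]. *)
have d0 : 0 < e / 4 by rewrite divr_gt0.
have [C C0 hC] := polyk_growth pm d0.
have rho0 x : 0 <= rho x by exact/ltW/rho_gt0.
pose b (x : E) := expR (- (e / 2 * sqn x)).
have mb : measurable_fun [set: E] b by exact: measurable_expsqn.
have b0 x : 0 <= b x by exact: expR_ge0.
have le x z : mehler m (x, z) ^+ 2 * rho z * rho x <= C ^+ 2 * b x * b z.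
  have -> : mehler m (x, z) ^+ 2 * rho z * rho x =
      m x z ^+ 2 * expR (- (2^-1 * qf M (A *m x - z) + 2^-1 * jform M N A x z)).
    have -> : expR (- (2^-1 * qf M (A *m x - z) + 2^-1 * jform M N A x z)) =
        gexp M (A *m x - z) ^+ 2 * gexp N x / gexp N z.
      rewrite /gexp -expRM_natl -expRN -!expRD /jform; congr expR.
      by field.
    have gz : gexp N z != 0 by rewrite gt_eqF// gexp_gt0.
    by rewrite /mehler /rho /=; field; rewrite gz gt_eqF.
  have m2 : m x z ^+ 2 <= C ^+ 2 * expR (e / 2 * (sqn x + sqn z)).
    have -> : expR (e / 2 * (sqn x + sqn z)) = expR (e / 4 * (sqn x + sqn z)) ^+ 2.
      by rewrite -expRM_natl; congr expR; field.
    rewrite -exprMn -[leLHS]real_normK ?num_real// lerXn2r// ?nnegrE//.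
    by rewrite mulr_ge0// expR_ge0.
  have -> : C ^+ 2 * b x * b z = C ^+ 2 * expR (e / 2 * (sqn x + sqn z)) *
      expR (- (e * (sqn x + sqn z))).
    by rewrite /b -[LHS]mulrA -[RHS]mulrA -!expRD; congr (_ * expR _); field.
  apply: ler_pM => //; rewrite ?sqr_ge0 ?expR_ge0// ler_expR lerN2.
  exact: he.
have mK2 : measurable_fun [set: E * E] (fun q => (mehler m q ^+ 2)%:E).
  by apply/measurable_EFinP/measurable_funX; exact: measurable_mehler.
have K20 q : (0 <= (mehler m q ^+ 2)%:E)%E by rewrite lee_fin sqr_ge0.
rewrite fubini_tonelli1// (ge0_integral_density measurable_rho rho0 muE'); last 2 first.
- exact: (measurable_fun_fubini_tonelli_F (fun q => (mehler m q ^+ 2)%:E)).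
- by move=> x; exact: integral_ge0.
have mK2x x : measurable_fun [set: E] (fun z => (mehler m (x, z) ^+ 2)%:E).
  exact: measurableT_comp mK2 (measurable_fun_pair _ _).
pose Ib := (\int[lebesgue_cV n]_z (b z)%:E)%E.
have Iblty : (Ib < +oo)%E by apply: integral_expsqn_lty; rewrite divr_gt0.
have Ib0 : (0 <= Ib)%E by apply: integral_ge0 => z _; rewrite lee_fin.
apply: (@le_lt_trans _ _ (\int[lebesgue_cV n]_x ((C ^+ 2)%:E * Ib * (b x)%:E))%E).
  apply: ge0_le_integral => //.
  - by move=> x _; rewrite mule_ge0 ?lee_fin// integral_ge0.
  - apply: emeasurable_funM; last (by apply/measurable_EFinP; exact: measurable_rho).
    exact: (measurable_fun_fubini_tonelli_F (fun q => (mehler m q ^+ 2)%:E)).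
  - by apply: emeasurable_funM => //; exact/measurable_EFinP.
  move=> x _; rewrite /= /fubini_F (ge0_integral_density measurable_rho rho0 muE')//.
  rewrite -ge0_integralZr ?lee_fin//; last 2 first.
  - apply: emeasurable_funM => //; by apply/measurable_EFinP; exact: measurable_rho.
  - by move=> z _; rewrite mule_ge0// lee_fin.
  rewrite muleAC -ge0_integralZl ?lee_fin ?mulr_ge0 ?sqr_ge0//; last 2 first.
  - exact/measurable_EFinP.
  - by move=> z _; rewrite lee_fin.
  apply: ge0_le_integral => //.
  - by move=> z _; do 2 (apply: mule_ge0; last by rewrite lee_fin).
  - apply: emeasurable_funM => //; apply: emeasurable_funM => //.
    by apply/measurable_EFinP; exact: measurable_rho.
  - by apply: emeasurable_funM => //; exact/measurable_EFinP.
  - by move=> z _; rewrite -!EFinM lee_fin; exact: le.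
rewrite ge0_integralZl//; last 3 first.
- exact/measurable_EFinP.
- by move=> z _; rewrite lee_fin.
- by rewrite mule_ge0// lee_fin sqr_ge0.
rewrite lte_mul_pinfty//.
- by rewrite mule_ge0// lee_fin sqr_ge0.
- by rewrite fin_numM// ge0_fin_numE.
Qed.

(** Distributions pair through Lebesgue measure, Hilbert-Schmidt operators through [mu]. The price
    of the exchange is the multiplier [psi / rho], which is bounded for a test function. *)
Lemma distribution_of_density (u psi : E -> R) :
  measurable_fun [set: E] u -> measurable_fun [set: E] psi ->
  distribution_of u psi = \int[mu]_x (u x * (psi x / rho x)).
Proof.
move=> mu_ mpsi; rewrite /distribution_of /Rintegral; congr fine.
rewrite -(integral_density_div measurable_rho rho_gt0 muE').
  by apply: eq_integral => x _; rewrite mulrA.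
by apply: measurable_funM; [exact: measurable_funM|exact: measurable_rhoV].
Qed.

Lemma test_function_bound (psi : E -> R) : test_function setT psi ->
  exists C, forall x, `|psi x / rho x| <= C.
Proof.
move=> [spsi [K [cK _ psiK]]].
have cpsi : continuous psi by move=> x; exact: (spsi [::] x Logic.I).2.
have crho : continuous rho.
  by apply: continuous_funM; [exact: cst_continuous|exact: continuous_gexp].
have [C C0 hC] := compact_support_bound cpsi psiK cK crho rho_gt0.
exists C => x; rewrite normrM normfV [`|rho x|]gtr0_norm ?rho_gt0//.
by rewrite ler_pdivrMr ?rho_gt0.
Qed.

Lemma distribution_of_mehler m v psi : polyk m -> v \in Lfun mu 2%:E ->
  test_function setT psi ->
  distribution_of (hsop mu (mehler m) v) psi =
  \int[mu]_z (v z * \int[lebesgue_cV n]_x (mehler m (x, z) * psi x)).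
Proof.
move=> pm v2 tpsi; have hk := hskernel_mehler pm.
have mpsi : measurable_fun [set: E] psi.
  by apply: continuous_measurable_cV => x; exact: (tpsi.1 [::] x Logic.I).2.
rewrite distribution_of_density//; last exact: hs_measurable.
have [C hC] := test_function_bound tpsi.
rewrite (hs_pairing hk v2 _ hC); last first.
  by apply: measurable_funM => //; exact: measurable_rhoV.
apply: eq_Rintegral => z _; congr (_ * _).
rewrite -(distribution_of_density (u := fun x => mehler m (x, z)))//.
exact: measurableT_comp (measurable_mehler pm) (measurable_fun_pair _ _).
Qed.

(** The derivative, first moved to the test function, is brought back onto [mehler m (x, z)] by
    integration by parts in [x] for each fixed [z]; [v] remains a mere factor in the integral over
    [z]. *)
Lemma dist_pderiv_mehler i m v : polyk m -> v \in Lfun mu 2%:E ->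
  exists2 m', polyk m' &
    eq_distribution setT (dist_pderiv i (distribution_of (hsop mu (mehler m) v)))
      (distribution_of (hsop mu (mehler m') v)).
Proof.
move=> pm v2; have [m' pm' dm] := mehler_derive i pm.
exists m' => // phi tphi; rewrite /dist_pderiv.
rewrite !distribution_of_mehler//; last exact: test_function_pderiv.
rewrite -RintegralN; apply: eq_Rintegral => z _; rewrite -mulrN; congr (_ * _).
rewrite /Rintegral (integral_by_parts (continuous_mehler (z := z) pm)
  (continuous_mehler (z := z) pm') (dm ^~ z))//.
by rewrite fineN opprK.
Qed.

Lemma dist_mderiv_mehler beta u m v : polyk m -> v \in Lfun mu 2%:E ->
  eq_distribution setT u (distribution_of (hsop mu (mehler m) v)) ->
  exists2 m', polyk m' & eq_distribution setT (dist_mderiv beta u)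
    (distribution_of (hsop mu (mehler m') v)).
Proof.
(* Agreement on test functions suffices for the induction, because [pderiv i] maps test functions to
   test functions. *)
move=> pm v2 um; pose C w := exists2 m', polyk m' &
  eq_distribution setT w (distribution_of (hsop mu (mehler m') v)).
have Cd i w : C w -> C (dist_pderiv i w).
  move=> [m1 pm1 wm1]; have [m2 pm2 m12] := dist_pderiv_mehler i pm1 v2.
  exists m2; first exact: pm2.
  move=> phi tphi; have E1 := m12 phi tphi.
  have E2 := wm1 (pderiv i phi) (test_function_pderiv i tphi).
  by rewrite -E1 /dist_pderiv E2.
have Cit i k w : C w -> C (iter k (dist_pderiv i) w).
  by move=> Cw; elim: k => //= k; exact: Cd.
have Cu : C u by exists m.
rewrite -/(C _) /dist_mderiv.
by elim: (enum 'I_n) => //= i s; exact: Cit.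
Qed.

Lemma polyk_monomial alpha : polyk (fun x _ : E => monomial alpha x).
Proof.
rewrite /monomial; elim: (index_enum _) => [|i s IH].
  by under eq_fun do under eq_fun do rewrite big_nil; exact: polyk_cst.
under eq_fun do under eq_fun do rewrite big_cons.
apply: polykM => //; elim: (alpha i) => [|k IHk]; first exact: polyk_cst.
by under eq_fun do under eq_fun do rewrite exprS; apply: polykM IHk; exact: polyk_l.
Qed.

Lemma dist_mul_monomial_mehler alpha u m v : polyk m -> v \in Lfun mu 2%:E ->
  eq_distribution setT u (distribution_of (hsop mu (mehler m) v)) ->
  in_L2 mu (dist_mul (monomial alpha) u).
Proof.
move=> pm v2 um; have hk := hskernel_mehler pm.
pose am (x z : E) := monomial alpha x * m x z.
have pam : polyk am by apply: polykM => //; exact: polyk_monomial.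
have hka := hskernel_mehler pam.
have mon_m : measurable_fun [set: E] (monomial alpha).
  apply: continuous_measurable_cV.
  by have H := polyk_continuous (polyk_monomial alpha); exact: (H 0).
exists (hsop mu (mehler am) v); first exact: hs_Lfun.
move=> phi tphi; rewrite /dist_mul um; last exact: test_function_monomial.
have mphi : measurable_fun [set: E] phi.
  by apply: continuous_measurable_cV => x; exact: (tphi.1 [::] x Logic.I).2.
have mh := hs_measurable hk v2; have mha := hs_measurable hka v2.
rewrite !distribution_of_density//; last exact: measurable_funM.
rewrite /Rintegral; congr fine; apply: ae_eq_integral => //.
- apply/measurable_EFinP; apply: measurable_funM => //.
  by apply: measurable_funM; [exact: measurable_funM|exact: measurable_rhoV].
- apply/measurable_EFinP; apply: measurable_funM => //.
  by apply: measurable_funM => //; exact: measurable_rhoV.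
apply: filterS (hs_ae_kernel hk) => x kx _; congr EFin.
have -> : hsop mu (mehler am) v x = monomial alpha x * hsop mu (mehler m) v x.
  rewrite /hsop -RintegralZl//; last exact: Lfun2_mul_integrable.
  by apply: eq_Rintegral => z _; rewrite /mehler /am /= !mulrA.
by ring.
Qed.

End mehler_kernel.

(** * Consequences of the invariance of mu *)

(** For a determinant that is not positive the constant of [gaussian] takes the default value 0.
    Total mass 1 excludes this and, as it also makes the integral of [gexp M] finite and nonzero,
    forces [M] to be positive definite. *)
Lemma gexp_normalized {R : realType} n (M : 'M[R]_n) (c : R) : 0 <= c ->
  (\int[lebesgue_cV n]_y (c * gexp M y)%:E = 1)%E ->
  [/\ 0 < c, (\int[lebesgue_cV n]_y (gexp M y)%:E < +oo)%E,
    (\int[lebesgue_cV n]_y (gexp M y)%:E)%E != 0%E & posdef M].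
Proof.
move=> c0; under eq_integral do rewrite EFinM.
have mg : measurable_fun [set: 'cV[R]_n] (fun y => (gexp M y)%:E).
  by apply/measurable_EFinP; exact: measurable_gexp.
rewrite ge0_integralZl//; last by move=> y _; rewrite lee_fin gexp_ge0.
set I := (\int[_]_y _)%E => cI.
have I0 : (0 <= I)%E by apply: integral_ge0 => y _; rewrite lee_fin gexp_ge0.
have cp : 0 < c.
  rewrite lt_def c0 andbT; apply/eqP => cz; move: cI.
  by rewrite cz mul0e => -[] /eqP; rewrite eq_sym oner_eq0.
have Ifin : (I < +oo)%E.
  rewrite ltey; apply/eqP => Ioo; move: cI.
  by rewrite Ioo gt0_muley ?lte_fin.
have In0 : I != 0%E.
  by apply/eqP => Iz; move: cI; rewrite Iz mule0 => -[] /eqP; rewrite eq_sym oner_eq0.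
by split=> //; exact: integrable_gexp_posdef.
Qed.

Lemma fine_eq1 {R : realType} (x : \bar R) : fine x = 1 -> x = 1%E.
Proof.
by case: x => [a /= ->//| |] /= h; have := oner_neq0 R; rewrite -h eqxx.
Qed.

Section invariance.
Context {R : realType} {n : nat}.
Local Notation E := 'cV[R]_n.
Variables (M N A : 'M[R]_n) (c r : R) (mu : probability E R).
Hypotheses (c0 : 0 <= c) (r0 : 0 <= r).
Hypothesis muE : has_density mu (fun x => r * gexp N x).
Let T (f : E -> R) x := \int[lebesgue_cV n]_y (c * gexp M y * f (A *m x - y)).
Hypothesis inv : forall f, bounded_continuous f -> \int[mu]_x T f x = \int[mu]_x f x.

Lemma integral_density1 : (\int[lebesgue_cV n]_y (r * gexp N y)%:E = 1)%E.
Proof. by have := muE measurableT; rewrite [LHS]probability_setT => <-. Qed.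

Let mu1 : \int[mu]_x (1 : R) = 1.
Proof.
rewrite /Rintegral; have /= -> := integral_cst mu measurableT (1%:E).
by rewrite probability_setT mule1.
Qed.

(** Invariance is applied to the constant function 1, whose image is the constant [fine] of the
    total mass. Infinite values have [fine] 0, so a [fine] equal to 1 determines the mass. *)
Lemma integral_transition1 : (\int[lebesgue_cV n]_y (c * gexp M y)%:E = 1)%E.
Proof.
apply: fine_eq1.
have bc1 : bounded_continuous (fun _ : E => 1 : R).
  by split; [exact: cst_continuous|exists 1 => x; rewrite normr1].
have := inv bc1; rewrite mu1 => <-.
rewrite /T; under [X in _ = \int[mu]_x X x]eq_fun do under eq_Rintegral do rewrite mulr1.
rewrite /Rintegral; have /= -> := integral_cst mu measurableT
  (fine (\int[lebesgue_cV n]_y (c * gexp M y)%:E))%:E.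
by rewrite probability_setT mule1.
Qed.

Let Mfacts := gexp_normalized c0 integral_transition1.
Let Nfacts := gexp_normalized r0 integral_density1.

Let mk : measurable_fun [set: E * E] (fun q => c * gexp M (A *m q.1 - q.2)).
Proof.
apply: measurable_funM => //; apply: measurable_gexp; apply: measurable_fun_cVB => //.
exact: measurable_fun_mulmx.
Qed.

Let mkx x : measurable_fun [set: E] (fun z => c * gexp M (A *m x - z)).
Proof. exact: (measurableT_comp mk (measurable_fun_pair _ _)). Qed.

Let k0 y : 0 <= c * gexp M y.
Proof. by rewrite mulr_ge0// gexp_ge0. Qed.

Lemma transitionE f x : measurable_fun [set: E] f ->
  T f x = \int[lebesgue_cV n]_z (c * gexp M (A *m x - z) * f z).
Proof.
move=> mf; rewrite /T /Rintegral; congr fine.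
rewrite -(integral_reflect (A *m x) (f := fun z => (c * gexp M (A *m x - z) * f z)%:E)).
  by apply: eq_integral => y _; rewrite opprB addrCA subrr addr0.
by apply/measurable_EFinP; apply: measurable_funM.
Qed.

Lemma integral_transition_kernel x :
  (\int[lebesgue_cV n]_z (c * gexp M (A *m x - z))%:E = 1)%E.
Proof.
rewrite -integral_transition1.
rewrite -[RHS](ge0_integral_reflect (A *m x)) => [//||y]; last by rewrite lee_fin.
by apply/measurable_EFinP; apply: measurable_funM => //; exact: measurable_gexp.
Qed.

(** Invariance equates [fine] values, whereas [joint_form_ge0] asks for an identity of extended
    integrals. As [f] is bounded by [K] and the kernel has mass 1, the integrals against [mu] are
    finite and nothing is lost; the constant [r] cancels. *)
Lemma transition_joint_form x z : 0 <= jform M N A x z.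
Proof.
have [cp _ _ _] := Mfacts; have [rp Noo Nn0 pN] := Nfacts.
apply: (joint_form_ge0 cp pN Noo Nn0) => f cf [K fK] f0 {x z}.
have mf : measurable_fun [set: E] f by exact: continuous_measurable_cV.
pose h x := (\int[lebesgue_cV n]_z (c * gexp M (A *m x - z) * f z)%:E)%E.
have h0 x : (0 <= h x)%E.
  by apply: integral_ge0 => z _; rewrite lee_fin; apply: mulr_ge0.
have hK x : (h x <= K%:E)%E.
  have -> : K%:E = (K%:E * \int[lebesgue_cV n]_z (c * gexp M (A *m x - z))%:E)%E.
    by rewrite integral_transition_kernel mule1.
  have K0 : 0 <= K by apply: le_trans (fK 0).
  rewrite -ge0_integralZl//; last 2 first.
  - exact/measurable_EFinP.
  - by move=> z _; rewrite lee_fin.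
  apply: ge0_le_integral => //.
  - by move=> z _; rewrite lee_fin; apply: mulr_ge0.
  - by apply/measurable_EFinP; exact: measurable_funM.
  - by apply: emeasurable_funM => //; exact/measurable_EFinP.
  - move=> z _; rewrite -EFinM lee_fin mulrC ler_wpM2r//.
    exact: le_trans (ler_norm _) (fK z).
pose kf (q : E * E) := (c * gexp M (A *m q.1 - q.2) * f q.2)%:E.
have mkf : measurable_fun [set: E * E] kf.
  apply/measurable_EFinP/measurable_funM => //.
  exact: measurableT_comp mf measurable_snd.
have kf0 q : (0 <= kf q)%E by rewrite /kf lee_fin; apply: mulr_ge0.
have mh : measurable_fun [set: E] h by exact: (measurable_fun_fubini_tonelli_F kf).
have hT x : (T f x)%:E = h x.
  have hfin : h x \is a fin_num by rewrite ge0_fin_numE// (le_lt_trans (hK x))// ltry.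
  by rewrite transitionE//; exact: fineK hfin.
have fin_mu (g : E -> \bar R) : measurable_fun [set: E] g -> (forall x, 0 <= g x)%E ->
    (forall x, g x <= K%:E)%E -> (\int[mu]_x g x)%E \is a fin_num.
  move=> mg g0 gK; rewrite ge0_fin_numE ?integral_ge0//.
  apply: (@le_lt_trans _ _ (\int[mu]_x (cst K%:E x))%E).
    by apply: ge0_le_integral => // x _; exact: le_trans (gK x).
  by rewrite integral_cst//= probability_setT mule1 ltry.
have hint : (\int[mu]_x h x = \int[mu]_x (f x)%:E)%E.
  have := inv (conj cf (ex_intro _ K fK)).
  rewrite /Rintegral; under [X in fine X = _]eq_integral do rewrite hT.
  move=> E1; rewrite -(fineK (fin_mu _ mh h0 hK)) E1 fineK//.
  apply: fin_mu => [|x|x]; first exact/measurable_EFinP.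
    by rewrite lee_fin.
  by rewrite lee_fin; exact: le_trans (ler_norm _) (fK x).
have mrho : measurable_fun [set: E] (fun x => r * gexp N x).
  by apply: measurable_funM => //; exact: measurable_gexp.
have rho0 x : 0 <= r * gexp N x by rewrite mulr_ge0// gexp_ge0.
have mg : measurable_fun [set: E] (fun x => (gexp N x)%:E).
  by apply/measurable_EFinP; exact: measurable_gexp.
have factor (g : E -> \bar R) : measurable_fun [set: E] g -> (forall x, 0 <= g x)%E ->
    (\int[mu]_x g x = r%:E * \int[lebesgue_cV n]_x (g x * (gexp N x)%:E))%E.
  move=> mg' g0; rewrite (ge0_integral_density mrho rho0 muE)// -ge0_integralZl//.
  - by apply: eq_integral => x _; rewrite EFinM muleCA.
  - exact: emeasurable_funM.
  - by move=> x _; rewrite mule_ge0// lee_fin gexp_ge0.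
have mfE : measurable_fun [set: E] (fun x => (f x)%:E) by exact/measurable_EFinP.
move: hint; rewrite !factor//.
have rn : r%:E != 0%E by rewrite eqe gt_eqF.
move=> /(congr1 (fun t => (r^-1%:E * t)%E)); rewrite !muleA -EFinM mulVf ?gt_eqF// !mul1e.
move=> E1; transitivity (\int[lebesgue_cV n]_x (h x * (gexp N x)%:E))%E; last first.
  by rewrite E1; apply: eq_integral => x _; rewrite EFinM.
apply: eq_integral => x _.
have mkfx : measurable_fun [set: E] (fun z => kf (x, z)).
  exact: measurableT_comp mkf (measurable_fun_pair _ _).
have kfx0 z : setT z -> (0 <= kf (x, z))%E by move=> _; exact: kf0.
have gx0 : (0 <= (gexp N x)%:E)%E by rewrite lee_fin gexp_ge0.
have <- := ge0_integralZr (lebesgue_cV n) measurableT mkfx kfx0 gx0.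
by apply: eq_integral => z _; rewrite -EFinM mulrAC.
Qed.

Lemma transition_mehler f x : measurable_fun [set: E] f ->
  T f x = hsop mu (mehler M N A r (fun _ _ => c)) f x.
Proof.
have [rp _ _ _] := Nfacts.
move=> mf; rewrite transitionE// /hsop /Rintegral; congr fine.
have mrho : measurable_fun [set: E] (fun x => r * gexp N x).
  by apply: measurable_funM => //; exact: measurable_gexp.
have rho0 z : 0 < r * gexp N z by rewrite mulr_gt0// gexp_gt0.
rewrite -(integral_density_div (f := fun z : E => c * gexp M (A *m x - z) * f z)
  mrho rho0 muE).
  by apply: eq_integral => z _; rewrite /mehler /=; congr EFin; rewrite mulrAC.
apply: measurable_funM; first by apply: measurable_funM.
exact: (@measurable_rhoV _ _ N r rp).
Qed.

End invariance.

(** * Smoothing and decay of the semigroup on L^2(mu) *)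

Theorem proposition2p1 (R : realType) (n : nat) (Q B : 'M[R]_n)
    (mu : probability 'cV[R]_n R)
    (S : R -> ('cV[R]_n -> R) -> ('cV[R]_n -> R)) :
  (0 < n)%N ->
  Q^T = Q ->
  (forall x : 'cV[R]_n, 0 <= (x^T *m Q *m x) 0 0) ->
  hypoelliptic Q B ->
  invariant_measure Q B mu ->
  has_density mu (gaussian (Q_infty Q B)) ->
  OU_semigroup mu Q B S ->
  forall v0 : 'cV[R]_n -> R, v0 \in Lfun mu 2%:E ->
  forall t : R, 0 < t -> forall alpha beta : 'I_n -> nat,
    in_L2 mu (dist_mul (monomial alpha)
      (dist_mderiv beta (distribution_of (S t v0)))).
Proof.
move=> _ _ _ _ inv dens [C0S _ ext] v0 v02 t t0 alpha beta.
pose A := expmx (t *: B); pose M := invmx (Q_at Q B t); pose N := invmx (Q_infty Q B).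
pose c := ((2 * pi) `^ (n%:R / 2) * Num.sqrt (\det (Q_at Q B t)))^-1.
pose r := ((2 * pi) `^ (n%:R / 2) * Num.sqrt (\det (Q_infty Q B)))^-1.
have c0 : 0 <= c by rewrite invr_ge0 mulr_ge0// powR_ge0.
have r0 : 0 <= r by rewrite invr_ge0 mulr_ge0// powR_ge0.
have muE : has_density mu (fun x => r * gexp N x) by exact: dens.
have markovE f : markov_semigroup Q B t f =
    fun x => \int[lebesgue_cV n]_y (c * gexp M y * f (A *m x - y)).
  by rewrite /markov_semigroup gt_eqF.
have inv' f : bounded_continuous f ->
    \int[mu]_x (\int[lebesgue_cV n]_y (c * gexp M y * f (A *m x - y))) = \int[mu]_x f x.
  by move=> bf; rewrite -(inv t f (ltW t0) bf) markovE.
have [cp _ _ pM] := gexp_normalized c0 (integral_transition1 inv').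
have [rp _ _ pN] := gexp_normalized r0 (integral_density1 muE).
have J0 := transition_joint_form c0 r0 muE inv'.
have hk := hskernel_mehler rp pM pN muE J0 (polyk_cst c).
pose K := hsop mu (mehler M N A r (fun _ _ => c)).
have K2 u : u \in Lfun mu 2%:E -> K u \in Lfun mu 2%:E by exact: hs_Lfun.
have S2 u : u \in Lfun mu 2%:E -> S t u \in Lfun mu 2%:E.
  by move=> u2; exact: (C0_L2 C0S (ltW t0)).
have [Cs Csb] := C0_bounded C0S (ltW t0).
pose D u := S t u - K u.
have SK : {ae mu, forall x, D v0 x = 0}.
  pose k2 := fine (\int[(mu \x mu)%E]_p (mehler M N A r (fun _ _ => c) p ^+ 2)%:E)%E.
  have k2E : (\int[(mu \x mu)%E]_p (mehler M N A r (fun _ _ => c) p ^+ 2)%:E)%E = k2%:E.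
    rewrite /k2 fineK// ge0_fin_numE; first by case: hk.
    by apply: integral_ge0 => p _; rewrite lee_fin sqr_ge0.
  (* From [(a - b) ^ 2 <= 2 a ^ 2 + 2 b ^ 2]: [Cs] bounds the norm of [S t], and [k2] is the squared
     Hilbert-Schmidt norm of [K]. *)
  apply: (@null_bounded_continuous R n mu D (2 * Cs ^+ 2 + 2 * k2)) => //.
  - move=> u u2; rewrite /D -[_ - _]addrC -scaleN1r.
    by apply: Lfun2_lin; [exact: K2|exact: S2].
  - move=> a u v u2 v2.
    apply: filterS2 (C0_linear C0S a (ltW t0) u2 v2) (hs_linear a hk u2 v2) => x Su Ku.
    rewrite /D -![(_ - _) x]/(_ x - _ x) Su -/K in Ku *.
    by rewrite Ku; ring.
  - move=> u u2; apply: le_trans (integral_sqrB_le (S2 _ u2) (K2 _ u2)) _.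
    have h1 := le_Lnorm2_sqr (Csb _ u2); have h2 := hs_bound hk u2.
    rewrite k2E in h2.
    have Ei : (\int[mu]_x (u x ^+ 2)%:E = (fine (\int[mu]_x (u x ^+ 2)%:E))%:E)%E.
      by rewrite fineK// integrable_fin_num//; exact: Lfun2_integrable_sqr.
    rewrite Ei -EFinM in h1; rewrite Ei -EFinM in h2; rewrite Ei.
    have two0 : (0 <= 2%:E :> \bar R)%E by rewrite lee_fin.
    apply: le_trans (leeD (lee_wpmul2l two0 h1) (lee_wpmul2l two0 h2)) _.
    rewrite -!EFinM -EFinD lee_fin le_eqVlt; apply/orP; left; apply/eqP; ring.
  - move=> f bf; apply: filterS (ext t f (ltW t0) bf) => x Sf.
    rewrite /D -[(_ - _) x]/(_ x - _ x) Sf markovE /K.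
    rewrite -(transition_mehler M A c r0 muE)// ?subrr//.
    by apply: continuous_measurable_cV; exact: bf.1.
(* Equality [mu]-almost everywhere suffices although distributions integrate against Lebesgue
   measure, because the pairing is first rewritten as an integral against [mu]. *)
have SE : eq_distribution setT (distribution_of (S t v0)) (distribution_of (K v0)).
  move=> phi [sphi _].
  have mphi : measurable_fun [set: 'cV[R]_n] phi.
    by apply: continuous_measurable_cV => x; exact: (sphi [::] x Logic.I).2.
  have [/Lfun2P[mS _] /Lfun2P[mK _]] := (S2 _ v02, K2 _ v02).
  rewrite !(distribution_of_density rp muE)// /Rintegral; congr fine.
  have mw : measurable_fun [set: 'cV[R]_n] (fun x => phi x / (r * gexp N x)).
    by apply: measurable_funM => //; exact: (@measurable_rhoV _ _ N r rp).
  apply: ae_eq_integral => //.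
  - by apply/measurable_EFinP; exact: measurable_funM.
  - by apply/measurable_EFinP; exact: measurable_funM.
  apply: filterS SK => x; rewrite /D -[(_ - _) x]/(_ x - _ x) => /eqP.
  by rewrite subr_eq0 => /eqP -> _.
have [m pm mE] := dist_mderiv_mehler rp pM pN muE J0 beta (polyk_cst c) v02 SE.
exact: (dist_mul_monomial_mehler rp pM pN muE J0 alpha pm v02 mE).
Qed.
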